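(* Let $1\le q\le p\le\infty$ and $1\le r\le s\le q'$ with $\frac1r=\frac1p+\frac1s$. Then for all Banach spaces $X,Y$, all operators $T\in\mathcal L(X,Y)$ and all $n\in\mathbb N$, $$\pi_{pq}^n(T)=\sup\big\{\pi_{r1}^n(TVD_\sigma)\ :\ V\in\mathcal L(\ell_{q'},X),\ D_\sigma:\ell_\infty\to\ell_{q'},\ \|\sigma\|_s\le1,\ \|V\|\le1\big\}.$$
   Context: $\mathcal L(X,Y)$ denotes the bounded linear operators between Banach spaces $X,Y$. $q'$ is the conjugate exponent of $q$, $\frac1q+\frac1{q'}=1$. For a scalar sequence $\sigma=(\sigma_k)_k$, $D_\sigma$ is the diagonal operator $D_\sigma(\tau)=(\sigma_k\tau_k)_k$, and $\|\sigma\|_s$ is the $\ell_s$ norm of $\sigma$. For $1\le q\le p\le\infty$, $n\in\mathbb N$ and $T\in\mathcal L(X,Y)$, the $(p,q)$-summing norm of $T$ with respect to $n$ vectors is $$\pi_{pq}^n(T)=\sup\Big\{\Big(\sum_{k=1}^n\|Tx_k\|^p\Big)^{1/p}\ :\ x_1,\dots,x_n\in X,\ \sup_{\|x^*\|_{X^*}\le1}\Big(\sum_{k=1}^n|\langle x_k,x^*\rangle|^q\Big)^{1/q}\le1\Big\}$$ (with maxima replacing the sums when an exponent is $\infty$); $\pi_{r1}^n$ is this quantity with $(p,q)$ replaced by $(r,1)$. *)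

(* Defs.v *)
From HB Require Import structures.
From mathcomp Require Import all_boot all_order all_algebra.
From mathcomp Require Import finmap.
From mathcomp Require Import all_classical all_reals all_analysis.
From mathcomp Require Import ess_sup_inf complex.

Set Implicit Arguments.
Unset Strict Implicit.
Unset Printing Implicit Defensive.
Import Order.TTheory GRing.Theory Num.Theory.
Import numFieldNormedType.Exports.
Local Open Scope classical_set_scope.
Local Open Scope ring_scope.

Variant scalar_kind := RealScalars | ComplexScalars.

Definition scalar_field (R : realType) (k : scalar_kind) : numFieldType :=
  match k with RealScalars => R | ComplexScalars => R[i] end.

Definition scalar_re (R : realType) (k : scalar_kind) : scalar_field R k -> R :=
  match k with RealScalars => id | ComplexScalars => @complex.Re R end.

Definition scalar_of_real (R : realType) (k : scalar_kind) : R -> scalar_field R k :=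
  match k with RealScalars => id | ComplexScalars => real_complex R end.

Section Scalars.
Variables (R : realType) (k : scalar_kind).
Local Notation K := (scalar_field R k).

Lemma scalar_ofK : cancel (@scalar_of_real R k) (@scalar_re R k).
Proof. by case: k. Qed.

Lemma scalar_reK (x : K) : x \is Num.real -> scalar_of_real k (scalar_re x) = x.
Proof. by case: k x => [x|x] //= xr; rewrite RRe_real. Qed.

Lemma scalar_ofD (a b : R) :
  scalar_of_real k (a + b) = scalar_of_real k a + scalar_of_real k b.
Proof. by case: k => //=; rewrite rmorphD. Qed.

Lemma scalar_ofM (a b : R) :
  scalar_of_real k (a * b) = scalar_of_real k a * scalar_of_real k b.
Proof. by case: k => //=; rewrite rmorphM. Qed.

Lemma scalar_of0 : scalar_of_real k (0 : R) = 0.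
Proof. by case: k. Qed.

Lemma scalar_of_le (a b : R) :
  (scalar_of_real k a <= scalar_of_real k b) = (a <= b).
Proof. by case: k => //=; rewrite lecR. Qed.

(* The norms of [normedModType K] take values in [K]; [rnorm] is the real
   number they stand for. *)
Definition rnorm (V : normedModType K) (x : V) : R := scalar_re `|x|.

Lemma rnormE (V : normedModType K) (x : V) : scalar_of_real k (rnorm x) = `|x|.
Proof. by rewrite scalar_reK// normr_real. Qed.

Lemma rnorm_ge0 (V : normedModType K) (x : V) : 0 <= rnorm x.
Proof. by rewrite -scalar_of_le scalar_of0 rnormE. Qed.

Lemma ler_rnormD (V : normedModType K) (x y : V) :
  rnorm (x + y) <= rnorm x + rnorm y.
Proof. by rewrite -scalar_of_le scalar_ofD !rnormE ler_normD. Qed.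

Lemma rnormZ (V : normedModType K) (a : K) (x : V) :
  rnorm (a *: x) = rnorm (a : K^o) * rnorm x.
Proof.
by apply: (can_inj scalar_ofK); rewrite scalar_ofM !rnormE normrZ.
Qed.

Lemma rnorm0 (V : normedModType K) : rnorm (0 : V) = 0.
Proof. by apply: (can_inj scalar_ofK); rewrite rnormE scalar_of0 normr0. Qed.

Lemma rnorm0_eq0 (V : normedModType K) (x : V) : rnorm x = 0 -> x = 0.
Proof. by move=> x0; apply: normr0_eq0; rewrite -rnormE x0 scalar_of0. Qed.

End Scalars.

Section CountingLnorm.
Variable R : realType.
Local Open Scope ereal_scope.
Local Notation "'N_ p [ f ]" := (Lnorm (@counting nat R) p f).

Lemma counting_setT_gt0 : 0 < @counting nat R [set: nat].
Proof.
rewrite /counting asboolF ?ltey//; exact: infinite_nat.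
Qed.

Lemma ae_counting (P : nat -> Prop) :
  (\forall i \ae @counting nat R, P i) -> forall i, P i.
Proof.
case=> A [_ A0 sA] i; apply: contrapT => Pi; have iA : A i by exact: sA.
have {}A0 : (if `[< finite_set A >] then (#|` fset_set A|%fset%:R)%:E
  else +oo) = 0 :> \bar R := A0.
case: (asboolP (finite_set A)) A0 => [finA|_] A0; last first.
  by have := ltry (0 : R); rewrite A0 ltxx.
have := EFin_inj A0 => /eqP; rewrite pnatr_eq0 cardfs_eq0 => /eqP A1.
by have : i \in fset_set A by [rewrite in_fset_set ?inE]; rewrite A1 in_fset0.
Qed.

Lemma le_Lnorm_counting (p : \bar R) (f g : nat -> \bar R) : 1 <= p ->
  (forall i, `|f i| <= `|g i|) -> 'N_p[f] <= 'N_p[g].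
Proof.
case: p => [p|_|]; last by [].
- rewrite lee_fin => p1 fg; have p0 := lt_le_trans (@ltr01 R) p1.
  rewrite !Lnorm_counting//.
  apply: gt0_ler_poweR; rewrite ?invr_ge0 ?(ltW p0)//.
  - by rewrite in_itv/= leey andbT; apply: nneseries_ge0 => *; exact: poweR_ge0.
  - by rewrite in_itv/= leey andbT; apply: nneseries_ge0 => *; exact: poweR_ge0.
  - apply: lee_nneseries => i _; first by rewrite poweR_ge0.
    by apply: gt0_ler_poweR; rewrite ?(ltW p0)// in_itv/= leey andbT.
- move=> fg; rewrite unlock counting_setT_gt0.
  by apply: le_ess_sup; apply/nearW => i /=.
Qed.

Lemma LnormZ_counting (p : \bar R) (c : R) (f : nat -> R) : 1 <= p ->
  'N_p[(fun i => (c * f i)%R%:E)] = `|c|%:E * 'N_p[(fun i => (f i)%:E)].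
Proof.
case: p => [p|_|]; last by [].
- rewrite lee_fin => p1; have p0 := lt_le_trans (@ltr01 R) p1.
  rewrite !Lnorm_counting//.
  rewrite (eq_eseriesr (g := fun i => (`|c| `^ p)%:E * `|(f i)%:E| `^ p)); last first.
    by move=> i _; rewrite EFinM abseM poweRM.
  rewrite nneseriesZl; last by move=> *; exact: poweR_ge0.
  rewrite -poweR_EFin poweRM ?poweR_ge0//; last first.
    by apply: nneseries_ge0 => *; exact: poweR_ge0.
  by rewrite -poweRrM mulfV ?gt_eqF// poweRe1.
- rewrite unlock counting_setT_gt0.
  rewrite -(@ess_supZl _ _ _ _ _ `|c|%R) ?counting_setT_gt0//.
  by congr ess_sup; apply/funext => i /=; rewrite normrM EFinM.
Qed.

End CountingLnorm.

Section SequenceSpaces.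
Variables (R : realType) (k : scalar_kind).
Local Notation K := (scalar_field R k).

(* The norm of $\ell_p$, as an extended real. *)
Definition seq_norm (p : \bar R) (x : nat -> K^o) : \bar R :=
  Lnorm (@counting nat R) p (fun i => (rnorm (x i))%:E).

Lemma seq_norm_ge0 p x : (0 <= seq_norm p x)%E.
Proof. exact: Lnorm_ge0. Qed.

Lemma seq_normD p x y : (1 <= p)%E ->
  (seq_norm p (x + y)%R <= seq_norm p x + seq_norm p y)%E.
Proof.
move=> p1; apply: le_trans (eminkowski _ _ _ p1) => //.
apply: le_Lnorm_counting => // i /=.
rewrite lee_fin !ger0_norm ?addr_ge0 ?rnorm_ge0//; exact: ler_rnormD.
Qed.

Lemma seq_normZ p (a : K) x : (1 <= p)%E ->
  seq_norm p (a *: x) = ((rnorm (a : K^o))%:E * seq_norm p x)%E.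
Proof.
move=> p1; rewrite -[in RHS](ger0_norm (rnorm_ge0 _)) -LnormZ_counting//.
by apply: eq_Lnorm => i; rewrite rnormZ.
Qed.

Lemma seq_norm_eq0 p x : (1 <= p)%E -> seq_norm p x = 0 -> x = 0.
Proof.
move=> p1 x0.
have /ae_counting x0E : \forall i \ae @counting nat R,
    [set: nat] i -> (rnorm (x i))%:E = \0%E i.
  exact: Lnorm_eq0_eq0 (lt_le_trans lte01 p1) x0.
apply/funext => i; apply: rnorm0_eq0; apply: EFin_inj.
exact: (x0E i Logic.I).
Qed.

Lemma rnorm_le_seq_normy x i : ((rnorm (x i))%:E <= seq_norm +oo x)%E.
Proof.
rewrite /seq_norm unlock counting_setT_gt0.
have /ae_counting/(_ i) := ess_sup_ge (@counting nat R)
  (abse \o (fun j => (rnorm (x j))%:E)).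
rewrite /= ger0_norm ?rnorm_ge0//.
Qed.

Variables (p : \bar R).

Definition ell_pred : {pred nat -> K^o} := mem [set x | (seq_norm p x < +oo)%E].

(* The sequence space $\ell_p$; the proof of [1 <= p] is a phantom argument that
   makes the norm structure inferable. *)
Record ell (p1 : (1 <= p)%E) := Ell {
  ell_val :> nat -> K^o;
  ell_valP : ell_val \in ell_pred }.

Variable p1 : (1 <= p)%E.

HB.instance Definition _ := [isSub of ell p1 for @ell_val p1].
HB.instance Definition _ := [Choice of ell p1 by <:].

Lemma ell_submod_closed : submod_closed ell_pred.
Proof.
split.
  rewrite inE /= -[0](scale0r (0 : nat -> K^o)) seq_normZ//.
  by rewrite rnorm0 mul0e.
move=> a x y; rewrite !inE /= => xfin yfin.
apply: le_lt_trans (seq_normD _ _ p1) _.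
rewrite lte_add_pinfty// seq_normZ// lte_mul_pinfty// ?lee_fin ?rnorm_ge0//.
Qed.

HB.instance Definition _ := GRing.isSubmodClosed.Build _ _ ell_pred
  ell_submod_closed.
HB.instance Definition _ := [SubChoice_isSubLmodule of ell p1 by <:].

Definition ell_norm (x : ell p1) : K := scalar_of_real k (fine (seq_norm p x)).

Lemma seq_norm_fin (x : ell p1) : (fine (seq_norm p x))%:E = seq_norm p x.
Proof.
rewrite fineK// ge0_fin_numE ?seq_norm_ge0//.
by have := ell_valP x; rewrite inE.
Qed.

Lemma ler_ell_normD (x y : ell p1) :
  ell_norm (x + y) <= ell_norm x + ell_norm y.
Proof.
rewrite /ell_norm -scalar_ofD scalar_of_le -lee_fin EFinD !seq_norm_fin.
exact: seq_normD.
Qed.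

Lemma ell_normZ (a : K) (x : ell p1) : ell_norm (a *: x) = `|a| * ell_norm x.
Proof.
rewrite /ell_norm -(@rnormE _ _ K^o a) -scalar_ofM; congr scalar_of_real.
by apply: EFin_inj; rewrite EFinM !seq_norm_fin; exact: seq_normZ.
Qed.

Lemma ell_norm0_eq0 (x : ell p1) : ell_norm x = 0 -> x = 0.
Proof.
rewrite /ell_norm -(scalar_of0 R k) => /(can_inj (@scalar_ofK R k)) x0.
apply: val_inj; apply: (seq_norm_eq0 p1).
by rewrite -[LHS]seq_norm_fin x0.
Qed.

HB.instance Definition _ := Lmodule_isNormed.Build K (ell p1)
  ler_ell_normD ell_normZ ell_norm0_eq0.

Lemma rnorm_ell (x : ell p1) : (rnorm x)%:E = seq_norm p x.
Proof.
by rewrite /rnorm -[(`|x|)]/(ell_norm x) /ell_norm scalar_ofK seq_norm_fin.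
Qed.

End SequenceSpaces.

Section Operators.
Variables (R : realType) (k : scalar_kind).
Local Notation K := (scalar_field R k).
Local Open Scope ereal_scope.

Definition op_norm (X Y : normedModType K) (T : {linear X -> Y}) : \bar R :=
  ereal_sup [set (rnorm (T x))%:E | x in [set x : X | (rnorm x <= 1)%R]].

Definition bounded_op (X Y : normedModType K) (T : {linear X -> Y}) : Prop :=
  bounded_near T (nbhs (0 : X)%R).

(* The norm of $\ell_p^n$ of a nonnegative vector; the junk branch is never
   reached for $p \ge 1$. *)
Definition fin_norm (p : \bar R) (n : nat) (a : 'I_n -> R) : R :=
  match p with
  | r%:E => ((\sum_(i < n) a i `^ r) `^ r^-1)%R
  | +oo => \big[Num.max/0%R]_(i < n) a i
  | -oo => 0%R
  end.

Definition weak_norm (X : normedModType K) (q : \bar R) (n : nat)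
    (x : 'I_n -> X) : \bar R :=
  ereal_sup [set (fin_norm q (fun i => rnorm (f (x i))))%:E
            | f in [set f : {linear X -> K^o} | bounded_op f /\ op_norm f <= 1]].

Definition summing_norm (X Y : normedModType K) (p q : \bar R) (n : nat)
    (T : {linear X -> Y}) : \bar R :=
  ereal_sup [set (fin_norm p (fun i => rnorm (T (x i))))%:E
            | x in [set x : 'I_n -> X | weak_norm q x <= 1]].

End Operators.

Section Diagonal.
Variables (R : realType) (k : scalar_kind) (p : \bar R) (p1 : (1 <= p)%E).
Local Notation K := (scalar_field R k).
Local Notation ell_infty := (ell k (leey (1 : \bar R))).

Lemma diag_subproof (sigma : ell k p1) (tau : ell_infty) :
  (fun i => sigma i * tau i : K^o) \in @ell_pred R k p.
Proof.
rewrite inE /=; pose c := fine (seq_norm +oo tau).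
apply: (@le_lt_trans _ _ (`|c|%:E * seq_norm p sigma)%E); last first.
  by rewrite lte_mul_pinfty// -seq_norm_fin ltry.
rewrite /seq_norm -LnormZ_counting//; apply: le_Lnorm_counting => // i.
rewrite /= lee_fin (rnormZ (sigma i) (tau i : K^o)).
rewrite normrM mulrC normrM ler_wpM2r// ger0_norm ?rnorm_ge0//.
apply: le_trans (ler_norm _); rewrite -lee_fin seq_norm_fin.
exact: rnorm_le_seq_normy.
Qed.

Definition diag_fun (sigma : ell k p1) (tau : ell_infty) : ell k p1 :=
  Ell p1 (diag_subproof sigma tau).

Lemma diag_is_linear sigma : linear (diag_fun sigma).
Proof.
move=> a x y; apply: val_inj; apply/funext => i /=.
by rewrite mulrDr; congr (_ + _); rewrite /GRing.scale /= mulrCA.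
Qed.

HB.instance Definition _ (sigma : ell k p1) :=
  GRing.isLinear.Build K ell_infty (ell k p1) _ (diag_fun sigma)
    (diag_is_linear sigma).

(* The multiplier is taken in $\ell_p$, i.e. such that $D_\sigma$ does map
   $\ell_\infty$ into $\ell_p$. *)
Definition diag_op (sigma : ell k p1) : {linear ell_infty -> ell k p1} :=
  diag_fun sigma.

End Diagonal.

(* Main.v *)
Require Import Defs.
From HB Require Import structures.
From mathcomp Require Import all_boot all_order all_algebra.
From mathcomp Require Import all_classical all_reals all_analysis.
From mathcomp Require Import ess_sup_inf complex.

(** For the lower bound on the supremum, let [x] have weak [q]-norm at most 1.
    The case of equality in Hölder's inequality gives [mu] in the unit ball of
    $\ell_s^n$ with $\|(\mu_k\|Tx_k\|)\|_r = \|(\|Tx_k\|)\|_p$; then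
    $V a = \sum_k a_k x_k$ (a contraction by Hahn-Banach and Hölder),
    $\sigma = \mu$ and the unit vectors of $\ell_\infty$ recover
    $\mu_k T x_k$.

    For the upper bound, a weakly 1-summable family $(\tau_k)$ in the unit ball
    is a matrix whose columns lie in the unit ball of $\ell_1^n$. For
    $s < \infty$ one may truncate to finitely many columns, and by convexity
    assume that each column has at most one nonzero entry, i.e. that the
    $\tau_k$ have disjoint supports. Then, with
    $\beta_k = \|\sigma\tau_k\|_s$, one has $\|\beta\|_s \le 1$, and
    $V D_\sigma \tau_k = \beta_k y_k$ where [y] has weak [q]-norm at most 1
    because the $\sigma\tau_k/\beta_k$ are disjoint with $\ell_{q'}$-norm at
    most their $\ell_s$-norm; Hölder's inequality concludes. For
    $s = \infty$ one has $q = 1$ and $r = p$, and $V D_\sigma$ is a contraction. *)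

Set Implicit Arguments.
Unset Strict Implicit.
Unset Printing Implicit Defensive.

Import Order.TTheory GRing.Theory Num.Theory.
Import numFieldNormedType.Exports.
Local Open Scope classical_set_scope.
Local Open Scope ring_scope.
Local Open Scope ereal_scope.

(** * Norms of finite families *)

Section FinNorm.
Context {R : realType}.
Implicit Types (p q r s : \bar R) (a b c t : R).
Local Open Scope ring_scope.

Lemma ler_powR_pos a b t : 0 < t -> 0 <= a -> 0 <= b ->
  (a `^ t <= b `^ t) = (a <= b).
Proof.
move=> t0 a0 b0; apply/idP/idP => [|ab]; last first.
  by apply: ge0_ler_powR => //; exact: ltW.
by apply: contraTT; rewrite -!ltNge => ba; apply: gt0_ltr_powR.
Qed.

Lemma powRVK a t : 0 <= a -> 0 < t -> (a `^ t^-1) `^ t = a.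
Proof. by move=> a0 t0; rewrite -powRrM mulVf ?gt_eqF// powRr1. Qed.

Lemma powRKV a t : 0 <= a -> 0 < t -> (a `^ t) `^ t^-1 = a.
Proof. by move=> a0 t0; rewrite -powRrM mulfV ?gt_eqF// powRr1. Qed.

Lemma fin_norm_ge0 {n} p (f : 'I_n -> R) : 0 <= fin_norm p f.
Proof.
case: p => [t| |] //=; first exact: powR_ge0.
exact: bigmax_ge_id.
Qed.

Lemma fin_normyP {n} c (f : 'I_n -> R) : 0 <= c ->
  (forall i, f i <= c) -> fin_norm +oo f <= c.
Proof. by move=> c0 fc; apply: bigmax_le. Qed.

Lemma fin_norm_powR {n} t (f : 'I_n -> R) : 0 < t ->
  fin_norm t%:E f `^ t = \sum_(i < n) f i `^ t.
Proof. by move=> t0; rewrite powRVK// sumr_ge0// => i _; exact: powR_ge0. Qed.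

Lemma fin_norm_le {n} t c (f : 'I_n -> R) : 0 < t -> 0 <= c ->
  (fin_norm t%:E f <= c) = (\sum_(i < n) f i `^ t <= c `^ t).
Proof. by move=> t0 c0; rewrite -(ler_powR_pos t0) ?fin_norm_ge0// fin_norm_powR. Qed.

Lemma ler_fin_norm {n} p (f g : 'I_n -> R) : (1 <= p)%E ->
  (forall i, 0 <= f i <= g i) -> fin_norm p f <= fin_norm p g.
Proof.
case: p => [t| |] // + fg.
  rewrite lee_fin => t1; have t0 := lt_le_trans ltr01 t1.
  rewrite fin_norm_le ?fin_norm_ge0// fin_norm_powR//.
  apply: ler_sum => i _; have /andP[f0 fgi] := fg i.
  by rewrite ler_powR_pos// (le_trans f0).
move=> _; apply: fin_normyP; first exact: fin_norm_ge0.
move=> i; have /andP[_ fgi] := fg i; apply: le_trans fgi _.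
exact: (le_bigmax _ g).
Qed.

Lemma fin_norm_ge {n} p (f : 'I_n -> R) i : (1 <= p)%E ->
  (forall i, 0 <= f i) -> f i <= fin_norm p f.
Proof.
case: p => [t| |] // + f0; last by move=> _; exact: (le_bigmax _ f).
rewrite lee_fin => t1; have t0 := lt_le_trans ltr01 t1.
rewrite -(ler_powR_pos t0) ?fin_norm_ge0// fin_norm_powR// (bigD1 i)//=.
by rewrite lerDl sumr_ge0// => j _; exact: powR_ge0.
Qed.

Lemma fin_norm0 {n} p : (1 <= p)%E -> fin_norm p (fun _ : 'I_n => 0) = 0.
Proof.
case: p => [t| |] //.
  rewrite lee_fin => t1; have t0 := lt_le_trans ltr01 t1.
  apply/le_anti; rewrite fin_norm_ge0 andbT fin_norm_le// powR0 ?gt_eqF//.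
  by rewrite big1.
by move=> _; apply/le_anti; rewrite fin_norm_ge0 andbT fin_normyP.
Qed.

Lemma fin_normZ {n} p c (f : 'I_n -> R) : (1 <= p)%E -> 0 <= c ->
  (forall i, 0 <= f i) -> fin_norm p (fun i => c * f i) = c * fin_norm p f.
Proof.
case: p => [t| |] //.
  rewrite lee_fin => t1 c0 f0; have t0 := lt_le_trans ltr01 t1.
  rewrite /fin_norm (eq_bigr (fun i => c `^ t * f i `^ t)); last first.
    by move=> i _; rewrite powRM.
  rewrite -mulr_sumr powRM ?powR_ge0 ?powRKV//.
  by rewrite sumr_ge0// => i _; exact: powR_ge0.
move=> _ c0 f0 /=.
by elim/big_rec2 : _ => [|i x y _ ->]; rewrite ?mulr0// maxr_pMr.
Qed.

Lemma fin_norm1 {n} (f : 'I_n -> R) : (forall i, 0 <= f i) ->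
  fin_norm 1%E f = \sum_(i < n) f i.
Proof.
move=> f0; rewrite /fin_norm invr1 powRr1; last first.
  by rewrite sumr_ge0// => i _; exact: powR_ge0.
by apply: eq_bigr => i _; rewrite powRr1.
Qed.

(** Separates the degenerate cases of Hölder's relation from the one where powers can be computed:
    if $p$ and $s$ are finite, then $1/p+1/s>0$, which rules out $q=\infty$. *)
Lemma hoelder_triple p q s : (1 <= q)%E -> (1 <= p)%E -> (1 <= s)%E ->
    (q^-1 = p^-1 + s^-1)%E ->
  [\/ s = +oo%E /\ q = p,
      p = +oo%E /\ q = s
    | exists r' p' s' : R, [/\ q = r'%:E, p = p'%:E, s = s'%:E,
        [/\ 1 <= r', 1 <= p' & 1 <= s'] & r'^-1 = p'^-1 + s'^-1]].
Proof.
case: s => [s'| |] //; last first.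
  move=> _ _ _; rewrite invey adde0 => /(can_inj (@inveK R)) qp.
  by constructor 1; split.
case: p => [p'| |] //; last first.
  move=> _ _ _; rewrite invey add0e => /(can_inj (@inveK R)) qp.
  by constructor 2; split.
case: q => [q'| |] //; rewrite ?lee_fin => q1 p1 s1.
  rewrite !inver !gt_eqF ?(lt_le_trans ltr01)// -EFinD => -[e].
  by constructor 3; exists q', p', s'.
rewrite invey !inver !gt_eqF ?(lt_le_trans ltr01)// -EFinD => -[e].
suff : 0 < p'^-1 + s'^-1 by rewrite -e ltxx.
by rewrite addr_gt0// invr_gt0 (lt_le_trans ltr01).
Qed.

Lemma hoelder_fin_norm {n} p q s (f g : 'I_n -> R) :
    (1 <= q)%E -> (1 <= p)%E -> (1 <= s)%E -> (q^-1 = p^-1 + s^-1)%E ->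
    (forall i, 0 <= f i) -> (forall i, 0 <= g i) ->
  fin_norm q (fun i => f i * g i) <= fin_norm p f * fin_norm s g.
Proof.
move=> q1 p1 s1 qps f0 g0.
have [[soo qp]|[poo qs]|] := hoelder_triple q1 p1 s1 qps.
- rewrite -qp mulrC -fin_normZ ?fin_norm_ge0//.
  apply: ler_fin_norm => // i; rewrite mulr_ge0//= mulrC ler_wpM2r//.
  exact: fin_norm_ge.
- rewrite -qs -fin_normZ ?fin_norm_ge0//.
  apply: ler_fin_norm => // i; rewrite mulr_ge0//= ler_wpM2r//.
  exact: fin_norm_ge.
move=> [q' [p' [s' [qE pE sE [q1' p1' s1'] e]]]].
have [q0 p0 s0] : [/\ 0 < q', 0 < p' & 0 < s'].
  by split; apply: lt_le_trans ltr01 _.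
set A := fin_norm p f; set B := fin_norm s g.
have A0 : 0 <= A by exact: fin_norm_ge0.
have B0 : 0 <= B by exact: fin_norm_ge0.
have [A_eq0|A_neq0] := eqVneq A 0.
  rewrite A_eq0 mul0r -(fin_norm0 (n := n) q1); apply: ler_fin_norm => // i.
  rewrite mulr_ge0//=; have : f i <= 0 by rewrite -A_eq0 fin_norm_ge.
  by move=> fi; rewrite (@le_anti _ _ (f i) 0) ?mul0r// fi f0.
have [B_eq0|B_neq0] := eqVneq B 0.
  rewrite B_eq0 mulr0 -(fin_norm0 (n := n) q1); apply: ler_fin_norm => // i.
  rewrite mulr_ge0//=; have : g i <= 0 by rewrite -B_eq0 fin_norm_ge.
  by move=> fi; rewrite (@le_anti _ _ (g i) 0) ?mulr0// fi g0.
have Ap : 0 < A by rewrite lt_neqAle eq_sym A_neq0.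
have Bp : 0 < B by rewrite lt_neqAle eq_sym B_neq0.
have -> : (fun i => f i * g i) = (fun i => (A * B) * ((f i / A) * (g i / B))).
  by apply/funext => i; rewrite mulrACA [A * _]mulrC [B * _]mulrC !divfK.
have fA i : 0 <= f i / A by rewrite divr_ge0.
have gB i : 0 <= g i / B by rewrite divr_ge0.
rewrite fin_normZ ?mulr_ge0// => [|i]; last by rewrite mulr_ge0.
rewrite ler_piMr ?mulr_ge0// qE fin_norm_le// powR1.
have powR11 t : 1 `^ t = 1 :> R by rewrite powR1.
have SA : \sum_(i < n) (f i / A) `^ p' <= 1.
  rewrite -[leRHS](powR11 p') -fin_norm_le// -pE.
  have -> : (fun i => f i / A) = (fun i => A^-1 * f i) by apply/funext => i; rewrite mulrC.
  by rewrite fin_normZ ?invr_ge0// mulVf.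
have SB : \sum_(i < n) (g i / B) `^ s' <= 1.
  rewrite -[leRHS](powR11 s') -fin_norm_le// -sE.
  have -> : (fun i => g i / B) = (fun i => B^-1 * g i) by apply/funext => i; rewrite mulrC.
  by rewrite fin_normZ ?invr_ge0// mulVf.
have qp0 : 0 <= q' / p' by rewrite divr_ge0 ?ltW.
have qs0 : 0 <= q' / s' by rewrite divr_ge0 ?ltW.
have qpsE : q' / p' + q' / s' = 1 by rewrite -mulrDr -e divff ?gt_eqF.
(* After normalization the bound to prove is $1 = q/p + q/s$; it follows termwise from Young's
   inequality with the conjugate exponents $p/q$ and $s/q$. *)
rewrite -qpsE.
apply: (@le_trans _ _ (q' / p' * \sum_(i < n) (f i / A) `^ p' +
   q' / s' * \sum_(i < n) (g i / B) `^ s')); last first.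
  by rewrite lerD// ler_piMr.
rewrite !mulr_sumr -big_split/=; apply: ler_sum => i _.
rewrite powRM//.
apply: le_trans (@conjugate_powR _ _ _ (p' / q') (s' / q') _ _ _ _ _) _;
  rewrite ?powR_ge0 ?divr_gt0//.
  by rewrite !invf_div.
by rewrite -!powRrM !invf_div ![q' * (_ / q')]mulrC !divfK ?gt_eqF// mulrC
  [X in _ + X]mulrC.
Qed.

(** The witness is the constant 1 if $s=\infty$, the indicator of an index where [f] is maximal if
    $p=\infty$, and $(f/\|f\|_p)^{p/s}$ when all exponents are finite. *)
Lemma hoelder_fin_norm_attained {n} p q s (f : 'I_n -> R) :
    (1 <= q)%E -> (1 <= p)%E -> (1 <= s)%E -> (q^-1 = p^-1 + s^-1)%E ->
    (forall i, 0 <= f i) ->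
  exists2 g : 'I_n -> R, (forall i, 0 <= g i) /\ fin_norm s g <= 1
    & fin_norm p f <= fin_norm q (fun i => g i * f i).
Proof.
move=> q1 p1 s1 qps f0.
have [[soo qp]|[poo qs]|] := hoelder_triple q1 p1 s1 qps.
- exists (fun=> 1); first by split => //; rewrite soo fin_normyP.
  rewrite qp; have -> // : (fun i => 1 * f i) = f by apply/funext => i; rewrite mul1r.
- have [f_eq0|] := eqVneq (fin_norm p f) 0.
    exists (fun=> 0); first by split => //; rewrite fin_norm0.
    by rewrite f_eq0 fin_norm_ge0.
  rewrite poo /= => fn0.
  (* A nonzero maximum is attained: otherwise all entries, and the initial value 0 of the iterated
     maximum, would lie strictly below it. *)
  have [m fm] : exists m, f m = fin_norm +oo f.
    apply: contrapT => /forallNP H.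
    have : \big[Num.max/0]_(i < n) f i < fin_norm +oo f.
      apply: bigmax_lt; first by rewrite lt_neqAle eq_sym fn0 fin_norm_ge0.
      move=> i _; rewrite lt_neqAle; apply/andP.
      split; first by apply/eqP; exact: H.
      exact: (le_bigmax _ f).
    by rewrite ltxx.
  exists (fun i => (i == m)%:R).
    split => [i|]; first exact: ler0n.
    case: s s1 {qps qs} => [s'| |]//; last first.
      by move=> _; apply: fin_normyP => // i; rewrite lern1 leq_b1.
    rewrite lee_fin => s1; rewrite fin_norm_le ?(lt_le_trans ltr01)//.
    rewrite powR1 (bigD1 m)//= eqxx powR1 big1 ?addr0// => i /negbTE ->.
    by rewrite powR0// gt_eqF// (lt_le_trans ltr01).
  have /= := fin_norm_ge (p := q) (f := fun i => (i == m)%:R * f i) m q1.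
  by rewrite eqxx mul1r fm; apply=> i; rewrite mulr_ge0.
move=> [q' [p' [s' [qE pE sE [q1' p1' s1'] e]]]].
have [q0 p0 s0] : [/\ 0 < q', 0 < p' & 0 < s'].
  by split; apply: lt_le_trans ltr01 _.
set A := fin_norm p f.
have A0 : 0 <= A by exact: fin_norm_ge0.
have [A_eq0|A_neq0] := eqVneq A 0.
  exists (fun=> 0); first by split => //; rewrite fin_norm0.
  by rewrite A_eq0 fin_norm_ge0.
have Ap : 0 < A by rewrite lt_neqAle eq_sym A_neq0.
have fA i : 0 <= f i / A by rewrite divr_ge0.
have SA : \sum_(i < n) (f i / A) `^ p' = 1.
  rewrite -fin_norm_powR// -pE.
  have -> : (fun i => f i / A) = (fun i => A^-1 * f i) by apply/funext => i; rewrite mulrC.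
  by rewrite fin_normZ ?invr_ge0// mulVf// powR1.
exists (fun i => (f i / A) `^ (p' / s')).
  split => [i|]; first exact: powR_ge0.
  rewrite sE fin_norm_le// powR1.
  by under eq_bigr do rewrite -powRrM divfK ?gt_eqF//; rewrite SA.
(* Since $p/s+1=p/q$, the $q$-th powers of the products are $A^q (f_i/A)^p$, and these sum to
   $A^q$. *)
have -> : (fun i => (f i / A) `^ (p' / s') * f i) =
    (fun i => A * ((f i / A) `^ (p' / s' + 1))).
  apply/funext => i; rewrite powRD; last first.
    by rewrite gt_eqF// addr_gt0// divr_gt0.
  by rewrite powRr1// mulrCA; congr (_ * _); rewrite mulrC divfK.
rewrite fin_normZ// => [|i]; last exact: powR_ge0.
rewrite ler_peMr// qE /fin_norm.
under eq_bigr do rewrite -powRrM.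
have -> : (p' / s' + 1) * q' = p'.
  have -> : p' / s' + 1 = p' * (p'^-1 + s'^-1).
    by rewrite mulrDr divff ?gt_eqF// addrC.
  by rewrite -e divfK ?gt_eqF.
by rewrite SA powR1.
Qed.

Lemma inv_hoelder_conjugate q : (1 <= q)%E ->
  (1^-1 = q^-1 + (hoelder_conjugate q)^-1)%E.
Proof.
move=> q1; rewrite hoelder_conjugate_eq1 ?inve1//.
- by rewrite (lt_le_trans _ q1)// ltNyr.
- by rewrite gt_eqF// (lt_le_trans _ q1).
Qed.

(** Minkowski by duality: some [h] in the unit ball for the conjugate exponent attains the norm of
    [f + g], and pairing with [h] is additive. *)
Lemma ler_fin_normD {n} p (f g : 'I_n -> R) : (1 <= p)%E ->
    (forall i, 0 <= f i) -> (forall i, 0 <= g i) ->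
  fin_norm p (fun i => f i + g i) <= fin_norm p f + fin_norm p g.
Proof.
move=> p1 f0 g0; have c1 := hoelder_conj_ge1 p1.
have e := inv_hoelder_conjugate p1.
have fg0 i : 0 <= f i + g i by rewrite addr_ge0.
have [h [h0 h1] hfg] := hoelder_fin_norm_attained (lexx 1%E) p1 c1 e fg0.
apply: le_trans hfg _; rewrite fin_norm1 => [|i]; last by rewrite mulr_ge0.
under eq_bigr do rewrite mulrDr; rewrite big_split/=.
have H (u : 'I_n -> R) : (forall i, 0 <= u i) ->
    \sum_(i < n) h i * u i <= fin_norm p u.
  move=> u0; rewrite -fin_norm1 => [|i]; last by rewrite mulr_ge0.
  have -> : (fun i => h i * u i) = (fun i => u i * h i) by apply/funext => i; rewrite mulrC.
  apply: le_trans (hoelder_fin_norm (lexx 1%E) p1 c1 e u0 h0) _.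
  by rewrite ler_piMr ?fin_norm_ge0.
by rewrite lerD// H.
Qed.

(** Every entry is at most $A=\|f\|_p$, so $f_i^q = f_i^p f_i^{q-p} \le f_i^p A^{q-p}$, and summing
    gives $A^q$. *)
Lemma fin_norm_exponent {n} p q (f : 'I_n -> R) : (1 <= p)%E -> (p <= q)%E ->
  (forall i, 0 <= f i) -> fin_norm q f <= fin_norm p f.
Proof.
move=> p1 pq f0; have q1 := le_trans p1 pq.
set A := fin_norm p f.
have A0 : 0 <= A by exact: fin_norm_ge0.
have fA i : f i <= A by exact: fin_norm_ge.
case: q q1 pq => [q'| |]//; last by move=> _ _; exact: fin_normyP.
case: p p1 @A A0 fA => [p'| |]// + A A0 fA; rewrite !lee_fin => p1 q1 pq.
have p0 := lt_le_trans ltr01 p1; have q0 := lt_le_trans ltr01 q1.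
rewrite fin_norm_le//.
have E x : x `^ q' = x `^ p' * x `^ (q' - p').
  by rewrite -powRD addrC subrK// gt_eqF.
rewrite E [A `^ p']fin_norm_powR// mulr_suml; apply: ler_sum => i _.
rewrite E ler_wpM2l ?powR_ge0//.
by apply: ge0_ler_powR; rewrite ?subr_ge0 ?nnegrE.
Qed.

Lemma fin_norm_exchange {m n} p (f : 'I_m -> 'I_n -> R) : (1 <= p)%E ->
    (forall i j, 0 <= f i j) ->
  fin_norm p (fun i => fin_norm p (f i)) <=
  fin_norm p (fun j => fin_norm p (fun i => f i j)).
Proof.
case: p => [t| |]// + f0.
  rewrite lee_fin => t1; have t0 := lt_le_trans ltr01 t1.
  rewrite fin_norm_le ?fin_norm_ge0// fin_norm_powR//.
  under eq_bigr do rewrite fin_norm_powR//.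
  under [leRHS]eq_bigr do rewrite fin_norm_powR//.
  by rewrite exchange_big.
move=> y1; apply: fin_normyP => [|i]; first exact: fin_norm_ge0.
apply: fin_normyP => [|j]; first exact: fin_norm_ge0.
apply: le_trans (fin_norm_ge (f := fun i => f i j) i y1 _) _ => //.
apply: (fin_norm_ge (f := fun j => fin_norm +oo (fun i => f i j))) => //.
by move=> k; exact: fin_norm_ge0.
Qed.

End FinNorm.

(** * Sublinear functionals and the Hahn-Banach theorem *)

Section HahnBanach.
Context {R : realType} {V : lmodType R}.
Implicit Types (p f : V -> R) (x y : V).
Local Open Scope ring_scope.

Definition sublinear p :=
  (forall x y, p (x + y) <= p x + p y) /\
  (forall t x, 0 <= t -> p (t *: x) <= t * p x).

Lemma sublinear0 p : sublinear p -> p 0 = 0.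
Proof.
move=> [pD pZ]; apply/le_anti/andP; split.
  by have := pZ 0 0 (lexx 0); rewrite scale0r mul0r.
by have := pD 0 0; rewrite addr0 -subr_ge0 addrK.
Qed.

Lemma sublinearZ p t x : sublinear p -> 0 <= t -> p (t *: x) = t * p x.
Proof.
move=> ps; have [pD pZ] := ps; rewrite le0r => /predU1P[->|t0].
  by rewrite scale0r mul0r sublinear0.
apply/le_anti; rewrite (pZ _ _ (ltW t0))/= -ler_pdivlMl//.
apply: le_trans (pZ t^-1 _ _); last by rewrite invr_ge0 ltW.
by rewrite scalerA mulVf ?gt_eqF// scale1r.
Qed.

Lemma sublinearN p x : sublinear p -> - p (- x) <= p x.
Proof.
move=> ps; rewrite lerNl -subr_ge0 opprK addrC -(sublinear0 ps) -(subrr x).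
exact: ps.1.
Qed.

(* The largest sublinear functional below [p] taking a value at most [- p y]
   at [- y]. *)
Definition slide p y x : R :=
  inf [set p (x + t *: y) - t * p y | t in [set t | 0 <= t]].

Section Slide.
Variables (p : V -> R) (y : V).
Hypothesis ps : sublinear p.

Lemma slide_le x t : 0 <= t -> slide p y x <= p (x + t *: y) - t * p y.
Proof.
move=> t0; apply: ge_inf; last by exists t.
(* The infimum is over a set bounded below: $s\,p(y) = p(sy) \le p(x+sy) + p(-x)$. *)
exists (- p (- x)) => _ [s s0 <-].
rewrite lerBrDr addrC lerBlDr -(sublinearZ _ ps)//.
have := ps.1 (x + s *: y) (- x); by rewrite addrAC subrr add0r.
Qed.

Lemma slide_ge x c : (forall t, 0 <= t -> c <= p (x + t *: y) - t * p y) ->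
  c <= slide p y x.
Proof.
move=> cp; apply: lb_le_inf; first by exists (p (x + 0 *: y) - 0 * p y), 0 => /=.
by move=> _ [t t0 <-]; exact: cp.
Qed.

Lemma slide_le_id x : slide p y x <= p x.
Proof. by have := slide_le x (lexx 0); rewrite scale0r addr0 mul0r subr0. Qed.

Lemma slideN : slide p y (- y) <= - p y.
Proof.
have := slide_le (- y) ler01.
by rewrite scale1r addNr mul1r sublinear0// add0r.
Qed.

(** Parameters add: near-optimal [t] and [s] for the two summands give the competitor [t + s] for
    the sum. Likewise, scaling the vector by [t > 0] scales the parameter by [t]. *)
Lemma slide_sublinear : sublinear (slide p y).
Proof.
split=> [x z|t x].
  rewrite -lerBlDr; apply: slide_ge => t t0; rewrite lerBlDr [leRHS]addrC -lerBlDr.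
  apply: slide_ge => s s0; rewrite lerBlDr.
  apply: le_trans (slide_le _ (addr_ge0 t0 s0)) _.
  rewrite scalerDl addrACA mulrDl opprD.
  by rewrite [leRHS]addrC [leRHS]addrACA lerD2r ps.1.
rewrite le0r => /predU1P[->|t0].
  by rewrite scale0r mul0r -(sublinear0 ps) slide_le_id.
rewrite -ler_pdivrMl//; apply: slide_ge => s s0; rewrite ler_pdivrMl//.
apply: le_trans (slide_le _ (mulr_ge0 (ltW t0) s0)) _.
by rewrite mulrBr -scalerA -scalerDr mulrA lerD2r sublinearZ// ltW.
Qed.

End Slide.

(** Zorn's lemma for the reversed pointwise order; the bound of a nonempty chain is its pointwise
    infimum, and [p] itself bounds the empty chain. *)
Lemma minimal_sublinear p : sublinear p ->
  exists2 f, sublinear f /\ (forall x, f x <= p x) &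
    forall g, sublinear g -> (forall x, g x <= f x) -> g = f.
Proof.
move=> ps; pose T := {f | sublinear f /\ forall x, f x <= p x}.
pose r (f g : T) := `[< forall x, sval g x <= sval f x >].
have [|||A Atot|[f [fs fp]] fmin] := @Zorn T r.
- by move=> f; apply/asboolP.
- move=> f g h /asboolP fg /asboolP gh; apply/asboolP => x.
  exact: le_trans (gh x) (fg x).
- move=> [f Pf] [g Pg] /asboolP/= fg /asboolP/= gf.
  suff fgE : f = g by subst g; congr exist; exact: Prop_irrelevance.
  by apply/funext => x; apply/le_anti; rewrite gf fg.
- have [[f0 Af0]|A0] := pselect (exists f : T, A f); last first.
    exists (exist _ p (conj ps (fun x => lexx (p x)))) => f Af.
    by exfalso; apply: A0; exists f.
  pose m x := inf [set sval f x | f in A].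
  have mle (f : T) x : A f -> m x <= sval f x.
    move=> Af; apply: ge_inf; last by exists f.
    exists (- p (- x)) => _ [[g [gs gp]] Ag <-] /=.
    by apply: le_trans (sublinearN _ gs); rewrite lerN2.
  have mge (c : R) x : (forall f : T, A f -> c <= sval f x) -> c <= m x.
    move=> cA; apply: lb_le_inf; first by exists (sval f0 x), f0.
    by move=> _ [f Af <-]; exact: cA.
  have ms : sublinear m.
    split=> [x y|t x].
      rewrite -lerBlDr; apply: (mge) => f Af; rewrite lerBlDr [leRHS]addrC -lerBlDr.
      apply: (mge) => g Ag; rewrite lerBlDr.
      (* Members [f] and [g] of the chain are comparable, so the smaller one can be applied to both
         [x] and [y]. *)
      have [/asboolP fg|/asboolP gf] := Atot f g Af Ag.
        apply: le_trans (mle _ _ Ag) _; apply: le_trans ((svalP g).1.1 _ _) _.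
        by rewrite [leRHS]addrC lerD2r.
      apply: le_trans (mle _ _ Af) _; apply: le_trans ((svalP f).1.1 _ _) _.
      by rewrite [leRHS]addrC lerD2l.
    rewrite le0r => /predU1P[->|t0].
      by rewrite scale0r mul0r (le_trans (mle _ _ Af0))// (sublinear0 (svalP f0).1).
    rewrite -ler_pdivrMl//; apply: mge => f Af; rewrite ler_pdivrMl//.
    apply: le_trans (mle _ _ Af) _.
    by rewrite (sublinearZ _ (svalP f).1)// ltW.
  have mp x : m x <= p x by apply: le_trans (mle _ _ Af0) _; exact: (svalP f0).2.
  exists (exist _ m (conj ms mp)) => f Af; apply/asboolP => x /=; exact: mle.
exists f => // g gs gf.
have gp x : g x <= p x := le_trans (gf x) (fp x).
by have /(congr1 sval) := fmin (exist _ g (conj gs gp)) (asboolT gf).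
Qed.

(** A minimal sublinear [f] equals each of its own slides, whence $f(x) \le f(x+y)-f(y)$ and [f] is
    additive. Sliding [p] along [x0] beforehand forces $f(-x_0)\le -p(x_0)$, so that [f] attains [p]
    at [x0]. *)
Lemma hahn_banach p x0 : sublinear p ->
  exists f : {linear V -> R^o}, (forall x, f x <= p x) /\ f x0 = p x0.
Proof.
move=> ps; have [f [fs fq] fmin] := minimal_sublinear (slide_sublinear x0 ps).
have fD x y : f (x + y) = f x + f y.
  apply/le_anti; rewrite fs.1/= -lerBrDr.
  rewrite -{1}(fmin _ (slide_sublinear y fs) (slide_le_id y fs)).
  by have := slide_le y fs x ler01; rewrite scale1r mul1r.
have fN x : f (- x) = - f x.
  by apply/eqP; rewrite -addr_eq0 -fD addNr sublinear0.
have fl : linear (f : V -> R^o).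
  move=> t x y; rewrite fD; congr (_ + _).
  have [t0|t0] := leP 0 t; first by rewrite sublinearZ.
  rewrite -[t]opprK scaleNr fN sublinearZ ?oppr_ge0 ?ltW//.
  by rewrite mulNr !opprK.
pose fL := GRing.isLinear.Build R V R^o _ (f : V -> R^o) fl.
pose F : {linear V -> R^o} := HB.pack (f : V -> R^o) fL.
exists F; have Fp x : F x <= p x by apply: le_trans (fq x) _; exact: slide_le_id.
split=> //; apply/le_anti; rewrite Fp/= -lerN2 -fN.
exact: le_trans (fq _) (slideN x0 ps).
Qed.

End HahnBanach.

(** * Functionals on real and complex normed modules *)

Section RealScalars.
Context {R : realType} {k : scalar_kind}.
Local Notation K := (scalar_field R k).
Local Open Scope ring_scope.
Implicit Types (a b : R) (z : K).

Lemma scalar_of1 : scalar_of_real k (1 : R) = 1.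
Proof. by case: k. Qed.

Lemma scalar_reD : {morph @scalar_re R k : x y / x + y}.
Proof. by case: k => // x y; rewrite /= raddfD. Qed.

Lemma scalar_re_le z : scalar_re z <= rnorm (z : K^o).
Proof.
rewrite -(scalar_of_le k) rnormE; case: k z => z /=; first exact: ler_norm.
by apply: le_trans (normc_ge_Re z); rewrite lecR ler_norm.
Qed.

Lemma rnorm_scalar_of_real a : rnorm (scalar_of_real k a : K^o) = `|a|.
Proof.
apply: (can_inj (@scalar_ofK R k)); rewrite rnormE; case: k => //=.
by apply: etrans (normc_def a%:C%C) _; rewrite /= expr0n addr0 sqrtr_sqr.
Qed.

Lemma rnormM z (w : K) : rnorm (z * w : K^o) = rnorm (z : K^o) * rnorm (w : K^o).
Proof. exact: (rnormZ z (w : K^o)). Qed.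

Lemma ler_rnorm_sum (X : normedModType K) n (x : 'I_n -> X) :
  rnorm (\sum_(i < n) x i) <= \sum_(i < n) rnorm (x i).
Proof.
elim/big_ind2 : _ => //; first by rewrite rnorm0.
by move=> x1 a x2 b h1 h2; apply: le_trans (ler_rnormD _ _) _; rewrite lerD.
Qed.

(** The conjugate of the sign of [z], written without conjugation so that it makes sense over both
    scalar fields. At [z = 0] it is 0, by the convention on division. *)
Definition phase z : K := `|z| / z.

Lemma phaseP z : phase z * z = scalar_of_real k (rnorm (z : K^o)).
Proof.
rewrite /phase (@rnormE R k K^o z); have [->|z0] := eqVneq z 0.
  by rewrite normr0 mulr0.
by rewrite divfK.
Qed.

Lemma rnorm_phase z : rnorm (phase z : K^o) <= 1.
Proof.
rewrite -(scalar_of_le k) rnormE scalar_of1 /phase normrM normfV normr_id.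
have [->|z0] := eqVneq z 0; first by rewrite normr0 mul0r.
by rewrite divff ?normr_eq0.
Qed.

End RealScalars.

Section RestrictScalars.
Context {R : realType} {k : scalar_kind}.
Local Notation K := (scalar_field R k).
Local Open Scope ring_scope.

(** An alias, so that the module structure over [R] does not clash with the one over [K]. *)
Definition realify (X : lmodType K) : Type := X.

Variable X : lmodType K.
HB.instance Definition _ := GRing.Zmodule.on (realify X).

Let scale a (x : realify X) : realify X := scalar_of_real k a *: (x : X).

Fact realify_scaleA a b x : scale a (scale b x) = scale (a * b) x.
Proof. by rewrite /scale scalerA scalar_ofM. Qed.
Fact realify_scale1 : left_id 1 scale.
Proof. by move=> x; rewrite /scale scalar_of1 scale1r. Qed.
Fact realify_scaleDr : right_distributive scale +%R.
Proof. by move=> a x y; rewrite /scale scalerDr. Qed.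
Fact realify_scaleDl x : {morph scale^~ x : a b / a + b}.
Proof. by move=> a b; rewrite /scale scalar_ofD scalerDl. Qed.

HB.instance Definition _ := GRing.Zmodule_isLmodule.Build R (realify X)
  realify_scaleA realify_scale1 realify_scaleDr realify_scaleDl.

Lemma realify_scaleE a (x : realify X) : a *: x = scalar_of_real k a *: (x : X).
Proof. by []. Qed.

End RestrictScalars.

Section RealPart.
Local Open Scope ring_scope.

(** In the complex case the functional with real part [u] is $f(x) = u(x) - i\,u(ix)$. *)
Lemma ex_linear_real_part {R : realType} {k : scalar_kind}
    (X : lmodType (scalar_field R k)) (u : {linear realify X -> R^o}) :
  exists f : {linear X -> (scalar_field R k)^o}, forall x, scalar_re (f x) = u x.
Proof.
case: k X u => X u.
  have ul : linear (u : X -> R^o) by move=> a x y; exact: (linearP u).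
  pose uL := GRing.isLinear.Build R X R^o _ (u : X -> R^o) ul.
  by exists (HB.pack (u : X -> R^o) uL : {linear X -> R^o}).
pose f (x : X) : R[i]^o := (u x +i* (- u ('i%C *: x)))%C.
have uD (x y : X) : u (x + y) = u x + u y by exact: (linearD u).
have uZ (a : R) (x : X) : u (a%:C%C *: x) = a * u x.
  exact: (@linearZ_LR _ _ _ _ u a (x : realify X)).
have fl : linear f.
  move=> z x y.
  have E (w : X) : z *: w = (complex.Re z)%:C%C *: w + (complex.Im z)%:C%C *: ('i%C *: w).
    by rewrite scalerA -scalerDl [_ * 'i%C]mulrC -complexE.
  rewrite /f E !scalerDr !uD !scalerA.
  rewrite ['i%C * (complex.Re z)%:C%C]mulrC.
  rewrite ['i%C * ((complex.Im z)%:C%C * _)]mulrCA (_ : 'i%C * 'i%C = (-1 : R)%:C%C); last by simpc.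
  rewrite -!scalerA !uZ.
  case: z {E} => b c; rewrite /GRing.scale/=; simpc; rewrite /=.
  by [].
pose fL := GRing.isLinear.Build R[i] X R[i]^o _ f fl.
by exists (HB.pack f fL : {linear X -> R[i]^o}).
Qed.

End RealPart.

Section Functionals.
Context {R : realType} {k : scalar_kind}.
Local Notation K := (scalar_field R k).
Local Open Scope ring_scope.

(** Hahn-Banach below the norm gives a real functional [u], the real part of some [f]. Multiplying
    [y] by the phase of [f y] makes the value real, so the bound on [u] passes to [f]. *)
Lemma norming_functional (X : normedModType K) (x : X) :
  exists f : {linear X -> K^o},
    (forall y, rnorm (f y) <= rnorm y) /\ rnorm (f x) = rnorm x.
Proof.
have rnorm_sub : sublinear (fun y : realify X => rnorm (y : X)).
  split=> [y z|t y t0]; first exact: (@ler_rnormD R k X y z).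
  by rewrite realify_scaleE rnormZ rnorm_scalar_of_real ger0_norm.
have [u [un ux]] := hahn_banach (x : realify X) rnorm_sub.
have [f fu] := ex_linear_real_part u.
have fle y : rnorm (f y) <= rnorm y.
  rewrite -[leLHS](@scalar_ofK R k) -phaseP.
  have -> : phase (f y) * f y = f (phase (f y) *: y) by rewrite linearZ.
  rewrite fu; apply: le_trans (un _) _; rewrite rnormZ ler_piMl ?rnorm_ge0//.
  exact: rnorm_phase.
exists f; split=> //; apply/le_anti; rewrite fle/= -[leLHS]ux -fu.
exact: scalar_re_le.
Qed.

Lemma bounded_opP (X Y : normedModType K) (T : {linear X -> Y}) :
  bounded_op T <-> exists c, forall x, rnorm (T x) <= c * rnorm x.
Proof.
split=> [/linear_boundedP Tb|[c Tc]].
  have [c [cr Hc]] := Tb.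
  have cr1 : c + 1 \is Num.real by rewrite realD// real1.
  (* The estimate is available for every constant strictly above [c]. *)
  exists (scalar_re (c + 1)) => x.
  rewrite -(scalar_of_le k) scalar_ofM scalar_reK// !rnormE.
  by apply: Hc; rewrite ltrDl.
apply/linear_boundedP; exists (scalar_of_real k c); split.
  by rewrite -[c]addr0; case: k => //=; rewrite complex_real.
move=> d cd x; rewrite -!rnormE.
apply: (@le_trans _ _ (scalar_of_real k (c * rnorm x))).
  by rewrite scalar_of_le.
rewrite scalar_ofM; apply: ler_wpM2r; last exact: ltW.
rewrite -(scalar_of0 R k) scalar_of_le; exact: rnorm_ge0.
Qed.

Lemma contractionP (X Y : normedModType K) (T : {linear X -> Y}) :
  (bounded_op T /\ (op_norm T <= 1)%E) <-> forall x, rnorm (T x) <= rnorm x.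
Proof.
split=> [[_ T1] x|Tle]; last first.
  split; first by apply/bounded_opP; exists 1 => x; rewrite mul1r.
  by apply: ge_ereal_sup => _ [x /= x1 <-]; rewrite lee_fin (le_trans (Tle x)).
have [x0|x0] := eqVneq (rnorm x) 0.
  by rewrite (rnorm0_eq0 x0) linear0 !rnorm0.
have xp : 0 < rnorm x by rewrite lt_neqAle eq_sym x0 rnorm_ge0.
have nx y : rnorm ((scalar_of_real k (rnorm x)^-1 : K) *: (y : X)) = (rnorm x)^-1 * rnorm y.
  by rewrite rnormZ rnorm_scalar_of_real ger0_norm// invr_ge0 ltW.
suff : rnorm (T (scalar_of_real k (rnorm x)^-1 *: x)) <= 1.
  rewrite linearZ/= rnormZ rnorm_scalar_of_real ger0_norm ?invr_ge0 ?rnorm_ge0//.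
  by rewrite ler_pdivrMl// mulr1.
rewrite -lee_fin; apply: le_trans T1; apply: ereal_sup_ubound.
by exists (scalar_of_real k (rnorm x)^-1 *: x) => //=; rewrite nx mulVf.
Qed.

Lemma weak_norm_le1 (X : normedModType K) q n (x : 'I_n -> X) :
  (weak_norm q x <= 1)%E <->
  forall f : {linear X -> K^o}, (forall y, rnorm (f y) <= rnorm y) ->
    fin_norm q (fun i => rnorm (f (x i))) <= 1.
Proof.
split=> [x1 f /contractionP f1|H].
  rewrite -lee_fin; apply: le_trans x1; apply: ereal_sup_ubound.
  by exists f.
apply: ge_ereal_sup => _ [f /= /contractionP f1 <-].
by rewrite lee_fin H.
Qed.

(** With $d_i = c_i\,\mathrm{phase}(f(x_i))$ the left side is $f(\sum_i d_i x_i)$. This turns weak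
    norms into norms of linear combinations. *)
Lemma sum_rnorm_functional (X : normedModType K) n (c : 'I_n -> R) (x : 'I_n -> X)
    (f : {linear X -> K^o}) : (forall i, 0 <= c i) ->
    (forall y, rnorm (f y) <= rnorm y) ->
  exists2 d : 'I_n -> K, forall i, rnorm (d i : K^o) <= c i &
    \sum_(i < n) c i * rnorm (f (x i)) <= rnorm (\sum_(i < n) d i *: x i).
Proof.
move=> c0 f1; exists (fun i => scalar_of_real k (c i) * phase (f (x i))).
  move=> i; rewrite rnormM rnorm_scalar_of_real ger0_norm// ler_piMr//.
  exact: rnorm_phase.
apply: le_trans (f1 _); apply: le_trans (scalar_re_le _).
rewrite linear_sum/=.
rewrite (big_morph _ (@scalar_reD R k) (id1 := 0)); last first.
  by rewrite -[RHS](@scalar_ofK R k) scalar_of0.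
apply: ler_sum => i _; rewrite linearZ/= /GRing.scale/= -mulrA phaseP.
by rewrite -scalar_ofM scalar_ofK.
Qed.

End Functionals.

(** * Sequence spaces *)

Section SeqNorm.
Context {R : realType} {k : scalar_kind}.
Local Notation K := (scalar_field R k).
Implicit Types (x : nat -> K^o) (p : \bar R).

Lemma seq_norm_real (p : R) x : (0 < p)%R ->
  seq_norm p%:E x = (\sum_(i <oo) (rnorm (x i) `^ p)%R%:E) `^ p^-1.
Proof.
move=> p0; rewrite /seq_norm Lnorm_counting//; congr (_ `^ _).
apply: eq_eseriesr => i _.
by rewrite /= ger0_norm// rnorm_ge0.
Qed.

Lemma fin_norm_le_seq_norm p n x : 1 <= p ->
  (fin_norm p (fun i : 'I_n => rnorm (x i)))%:E <= seq_norm p x.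
Proof.
case: p => [p| |] //.
  rewrite lee_fin => p1; have p0 := lt_le_trans (@ltr01 R) p1.
  rewrite seq_norm_real// /fin_norm -poweR_EFin.
  have u0 i : 0 <= (rnorm (x i) `^ p)%R%:E by rewrite lee_fin powR_ge0.
  apply: gt0_ler_poweR; rewrite ?invr_ge0 ?(ltW p0)//.
  - by rewrite in_itv/= leey andbT lee_fin sumr_ge0// => i _; exact: powR_ge0.
  - by rewrite in_itv/= leey andbT; exact: nneseries_ge0.
  - rewrite -sumEFin -(big_mkord xpredT (fun i => (rnorm (x i) `^ p)%:E)).
    by apply: nneseries_lim_ge => *; exact: u0.
move=> _; have := seq_norm_ge0 +oo x; have := rnorm_le_seq_normy x.
case: (seq_norm +oo x) => [c| |] // xc c0; rewrite ?leey// lee_fin.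
by apply: fin_normyP => // i; rewrite -lee_fin.
Qed.

(** With [fin_norm_le_seq_norm], this identifies the norm of a sequence with the supremum over its
    initial segments, so finite inequalities carry over. *)
Lemma seq_norm_le p x (c : R) : 1 <= p -> (0 <= c)%R ->
  (forall n, (fin_norm p (fun i : 'I_n => rnorm (x i)) <= c)%R) ->
  seq_norm p x <= c%:E.
Proof.
case: p => [p| |] //.
  rewrite lee_fin => p1 c0 xc; have p0 := lt_le_trans (@ltr01 R) p1.
  rewrite seq_norm_real//.
  have u0 i : 0 <= (rnorm (x i) `^ p)%R%:E by rewrite lee_fin powR_ge0.
  rewrite -[c in leRHS](powRKV c0 p0) -poweR_EFin.
  apply: gt0_ler_poweR; rewrite ?invr_ge0 ?(ltW p0)//.
  - by rewrite in_itv/= leey andbT; exact: nneseries_ge0.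
  - by rewrite in_itv/= leey andbT lee_fin powR_ge0.
  - apply: lime_le; first by apply: is_cvg_nneseries => *; exact: u0.
    apply: nearW => n; rewrite big_mkord sumEFin lee_fin -fin_norm_le//.
move=> _ c0 xc; rewrite /seq_norm unlock counting_setT_gt0.
apply/ess_supP/nearW => i /=; rewrite lee_fin ger0_norm ?rnorm_ge0//.
apply: le_trans (xc i.+1).
exact: (fin_norm_ge (f := fun j : 'I_i.+1 => rnorm (x j)) ord_max (leey 1)
  (fun=> rnorm_ge0 _)).
Qed.

Lemma seq_norm_exponent p q x : 1 <= p -> p <= q ->
  seq_norm q x <= seq_norm p x.
Proof.
move=> p1 pq; have := fin_norm_le_seq_norm _ x p1; have := seq_norm_ge0 p x.
case: (seq_norm p x) => [c| |] // c0 xc; rewrite ?leey//.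
apply: seq_norm_le => // [|n]; first exact: le_trans pq.
rewrite -lee_fin (le_trans _ (xc n))// lee_fin fin_norm_exponent// => i.
exact: rnorm_ge0.
Qed.

Lemma seq_normM_le p x (y : nat -> K^o) : 1 <= p -> (forall i, (rnorm (y i) <= 1)%R) ->
  seq_norm p (fun i => x i * y i : K^o)%R <= seq_norm p x.
Proof.
move=> p1 y1; apply: le_Lnorm_counting => // i; rewrite lee_fin !ger0_norm ?rnorm_ge0//.
by rewrite rnormM ler_piMr ?rnorm_ge0.
Qed.

Definition tail_seq N x : nat -> K^o := fun i => if (i < N)%N then 0%R else x i.

(** Tails of a convergent series tend to 0. This fails for exponent $\infty$, which is why
    $s=\infty$ is treated separately later. *)
Lemma tail_seq_norm_small (p e : R) x : (1 <= p)%R -> (0 < e)%R ->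
  seq_norm p%:E x < +oo -> exists N, seq_norm p%:E (tail_seq N x) <= e%:E.
Proof.
move=> p1 e0; have p0 := lt_le_trans (@ltr01 R) p1.
have u0 i : 0 <= (rnorm (x i) `^ p)%R%:E by rewrite lee_fin powR_ge0.
rewrite seq_norm_real// => /lty_poweRy-/(_ _) xfin.
have {}xfin : \sum_(i <oo) (rnorm (x i) `^ p)%R%:E < +oo.
  by apply: xfin; rewrite invr_eq0 gt_eqF.
have /fine_cvgP[_ /cvgrPdist_lt/(_ (e `^ p)%R)] := nneseries_tail_cvg xfin (fun i _ => u0 i).
rewrite powR_gt0// => /(_ isT).
move=> [N _ /(_ N (leqnn N))] /=; rewrite sub0r normrN => small.
exists N; rewrite seq_norm_real//.
rewrite (nneseries_split 0 N); last by move=> i _; rewrite lee_fin powR_ge0.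
rewrite big_mkord add0n big1 ?add0e => [|i _]; last first.
  by rewrite /tail_seq ltn_ord rnorm0 powR0// gt_eqF.
rewrite ereal_series (eq_eseriesr (g := fun i => (rnorm (x i) `^ p)%:E)); last first.
  by move=> i Ni; rewrite /tail_seq ltnNge Ni.
rewrite -ereal_series -[e in leRHS](powRKV (ltW e0) p0) -poweR_EFin.
have tail0 : 0 <= \sum_(N <= i <oo) (rnorm (x i) `^ p)%:E by exact: nneseries_ge0.
apply: gt0_ler_poweR; rewrite ?invr_ge0 ?(ltW p0)//.
- by rewrite in_itv/= leey andbT.
- by rewrite in_itv/= leey andbT lee_fin powR_ge0.
have tailfin : \sum_(N <= i <oo) (rnorm (x i) `^ p)%:E \is a fin_num.
  rewrite ge0_fin_numE//; apply: le_lt_trans xfin.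
  rewrite [leRHS](nneseries_split 0 N)// add0n leeDr//.
  by rewrite sume_ge0.
rewrite -[leLHS]fineK// lee_fin ltW// (le_lt_trans _ small)//.
exact: ler_norm.
Qed.

Definition fin_seq_fun N (a : 'rV[K]_N) : nat -> K^o :=
  fun j => if insub j is Some i then a ord0 i else 0%R.

Lemma fin_seq_funE N (a : 'rV[K]_N) (i : 'I_N) : fin_seq_fun a i = a ord0 i.
Proof. by rewrite /fin_seq_fun valK. Qed.

Lemma fin_seq_fun_out N (a : 'rV[K]_N) j : (N <= j)%N -> fin_seq_fun a j = 0%R.
Proof. by move=> Nj; rewrite /fin_seq_fun insubF// ltnNge Nj. Qed.

Lemma seq_norm_fin_seq p N (a : 'rV[K]_N) : 1 <= p ->
  seq_norm p (fin_seq_fun a) <= (fin_norm p (fun i => rnorm (a ord0 i : K^o)))%:E.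
Proof.
move=> p1; apply: seq_norm_le => // [|M]; first exact: fin_norm_ge0.
case: p p1 => [p| |] // p1; last first.
  apply: fin_normyP => [|i]; first exact: fin_norm_ge0.
  rewrite /fin_seq_fun; case: insubP => [j _ _|_]; last by rewrite rnorm0 fin_norm_ge0.
  exact: (fin_norm_ge (f := fun j => rnorm (a ord0 j : K^o)) j p1 (fun=> rnorm_ge0 _)).
have {}p1 : (1 <= p)%R by rewrite -lee_fin.
have p0 := lt_le_trans (@ltr01 R) p1.
rewrite fin_norm_le ?fin_norm_ge0// fin_norm_powR//.
pose G i := (rnorm (fin_seq_fun a i) `^ p)%R.
(* Summing up to [N + M] covers both the first [M] terms and all [N] entries of [a], whatever the
   order of [M] and [N]. *)
apply: (@le_trans _ _ (\sum_(i < N + M) G i)%R).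
  rewrite -(big_mkord xpredT G) -[leRHS](big_mkord xpredT G).
  rewrite [leRHS](big_cat_nat (n := M)) ?leq_addl//= lerDl.
  by rewrite sumr_ge0// => i _; exact: powR_ge0.
rewrite big_split_ord/= [X in (_ + X)%R]big1 ?addr0 => [|i _].
  by apply: ler_sum => i _; rewrite /G fin_seq_funE.
by rewrite /G fin_seq_fun_out ?leq_addr// rnorm0 powR0// gt_eqF.
Qed.

Variables (p : \bar R) (p1 : 1 <= p).

Lemma fin_seq_subproof N (a : 'rV[K]_N) : fin_seq_fun a \in @ell_pred R k p.
Proof. by rewrite inE/=; exact: le_lt_trans (seq_norm_fin_seq a p1) (ltry _). Qed.

Definition fin_seq N (a : 'rV[K]_N) : ell k p1 := Ell p1 (fin_seq_subproof a).

Lemma fin_seq_is_linear N : linear (@fin_seq N).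
Proof.
move=> a x y; apply: val_inj; apply/funext => j.
change (fin_seq_fun (a *: x + y)%R j = a * fin_seq_fun x j + fin_seq_fun y j)%R.
rewrite /fin_seq_fun; case: insubP => [i _ _|_]; first by rewrite !mxE.
by rewrite mulr0 addr0.
Qed.

HB.instance Definition _ N := GRing.isLinear.Build K 'rV[K]_N (ell k p1) _
  (@fin_seq N) (@fin_seq_is_linear N).

Lemma rnorm_fin_seq N (a : 'rV[K]_N) :
  (rnorm (fin_seq a) <= fin_norm p (fun i => rnorm (a ord0 i : K^o)))%R.
Proof. by rewrite -lee_fin rnorm_ell seq_norm_fin_seq. Qed.

End SeqNorm.

(** * Reduction to disjoint supports *)

Section DisjointColumns.
Context {R : realType} {k : scalar_kind}.
Local Notation K := (scalar_field R k).
Local Open Scope ring_scope.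

Lemma polar (z : K) : exists u : K,
  rnorm (u : K^o) <= 1 /\ scalar_of_real k (rnorm (z : K^o)) * u = z.
Proof.
exists (z / `|z|); rewrite (@rnormE R k K^o z); have [->|z0] := eqVneq z 0.
  by rewrite mul0r mulr0 rnorm0.
rewrite mulrCA divff ?normr_eq0// mulr1; split=> //.
rewrite -(scalar_of_le k) rnormE scalar_of1 normrM normfV normr_id.
by rewrite divff ?normr_eq0.
Qed.

(** Imposed on all columns, this says that the rows of [A] have disjoint supports. *)
Definition disjoint_col n N (A : 'M[K]_(n, N)) (i : 'I_N) : Prop :=
  forall j l, j != l -> A j i = 0 \/ A l i = 0.

Definition col_le1 n N (A : 'M[K]_(n, N)) : Prop :=
  forall i, \sum_(j < n) rnorm (A j i : K^o) <= 1.

Lemma rnorm_sum_disjoint n p (u : 'I_n -> K) : (1 <= p)%E ->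
    (forall j l, j != l -> u j = 0 \/ u l = 0) ->
  rnorm (\sum_(j < n) u j : K^o) <= fin_norm p (fun j => rnorm (u j : K^o)).
Proof.
move=> p1 disj; have [[j /eqP uj]|u0] := pselect (exists j, u j <> 0).
  rewrite (bigD1 j)//= big1 ?addr0 => [|l lj].
    by apply: (fin_norm_ge (f := fun j => rnorm (u j : K^o))) => // l; exact: rnorm_ge0.
  by have [u0|//] := disj _ _ lj; case: (disj _ _ lj) => // /eqP; rewrite (negbTE uj).
rewrite big1 ?rnorm0 ?fin_norm_ge0// => j _.
by apply: contrapT => uj; apply: u0; exists j.
Qed.

(* A matrix whose columns lie in the unit ball of $\ell_1^n$ is a convex
   combination of matrices whose columns have at most one nonzero entry, which
   we reach by splitting one column at a time. *)
Lemma disjoint_col_ind n N (Phi : 'M[K]_(n, N) -> R) (M : R) :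
    (forall A B, Phi (A + B) <= Phi A + Phi B) ->
    (forall t A, 0 <= t -> Phi (scalar_of_real k t *: A) <= t * Phi A) ->
    (forall A, col_le1 A -> (forall i, disjoint_col A i) -> Phi A <= M) ->
  forall A, col_le1 A -> Phi A <= M.
Proof.
move=> PhiD PhiZ PhiM.
(* [m] counts the leading columns that may still have several nonzero entries. *)
suff H m : (m <= N)%N -> forall A, col_le1 A ->
    (forall i : 'I_N, (m <= i)%N -> disjoint_col A i) -> Phi A <= M.
  move=> A A1; apply: (H N) => // i; by rewrite leqNgt ltn_ord.
elim: m => [_ A A1 Ad|m IH mN A A1 Ad].
  by apply: PhiM => // i; exact: Ad.
pose i0 := Ordinal mN.
pose repl (u : 'I_n -> K) : 'M[K]_(n, N) :=
  \matrix_(j, i) if i == i0 then u j else A j i.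
have replM v : \sum_(j < n) rnorm (v j : K^o) <= 1 ->
    (forall j l, j != l -> v j = 0 \/ v l = 0) -> Phi (repl v) <= M.
  move=> v1 vd; apply: IH => [|i|i]; first exact: ltnW.
    have [->|ii0] := eqVneq i i0.
      by under eq_bigr do rewrite mxE eqxx.
    by under eq_bigr do rewrite mxE (negbTE ii0); exact: A1.
  have [-> _ j l jl|ii0 mi j l jl] := eqVneq i i0.
    by rewrite !mxE eqxx; exact: vd.
  rewrite !mxE (negbTE ii0); apply: Ad jl.
  by rewrite ltn_neqAle mi andbT eq_sym.
pose w j := rnorm (A j i0 : K^o).
have w0 j : 0 <= w j by exact: rnorm_ge0.
pose S := \sum_(j < n) w j.
have S1 : S <= 1 by exact: A1.
have /choice[ph phP] := fun j => polar (A j i0).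
pose v j l : K := if l == j then ph j else 0.
have PhiM1 j : Phi (repl (v j)) <= M.
  apply: replM => [|l l' ll'].
    rewrite (bigD1 j)//= /v eqxx big1 ?addr0 => [|l /negbTE->]; last exact: rnorm0.
    by have [] := phP j.
  rewrite /v; case: (eqVneq l j) => [lj|_]; last by left.
  by right; rewrite -lj eq_sym (negbTE ll').
have PhiM0 : Phi (repl (fun=> 0)) <= M.
  apply: replM => [|*]; last by left.
  by rewrite big1// => j _; exact: rnorm0.
(* The weights are the absolute values of the entries of column [i0], and a zero column takes the
   remaining weight [1 - S]. As the weights add up to 1, the other columns are reproduced
   unchanged. *)
have AE : A = \sum_(j < n) scalar_of_real k (w j) *: repl (v j) +
              scalar_of_real k (1 - S) *: repl (fun=> 0).
  apply/matrixP => l i; rewrite mxE summxE mxE.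
  have [->|ii0] := eqVneq i i0; last first.
    under eq_bigr do rewrite !mxE (negbTE ii0).
    rewrite mxE (negbTE ii0) -mulr_suml -mulrDl.
    rewrite -(big_morph _ (@scalar_ofD R k) (scalar_of0 R k)) -scalar_ofD.
    by rewrite addrC subrK scalar_of1 mul1r.
  under eq_bigr do rewrite !mxE eqxx.
  rewrite mxE eqxx mulr0 addr0 (bigD1 l)//= /v eqxx big1 ?addr0 => [|j jl].
    by have [_ ->] := phP l.
  by rewrite eq_sym (negbTE jl) mulr0.
have Phi0 : Phi 0 <= 0.
  by have := PhiZ 0 0 (lexx 0); rewrite scaler0 mul0r.
rewrite AE; apply: le_trans (PhiD _ _) _.
apply: (@le_trans _ _ (S * M + (1 - S) * M)); last by rewrite -mulrDl addrC subrK mul1r.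
apply: lerD; last first.
  apply: le_trans (PhiZ _ _ _) _; first by rewrite subr_ge0.
  by rewrite ler_wpM2l// subr_ge0.
rewrite mulr_suml; elim/big_ind2 : _ => // [B b C c Bb Cc|j _].
  by apply: le_trans (PhiD _ _) _; rewrite lerD.
by apply: le_trans (PhiZ _ _ (w0 j)) _; rewrite ler_wpM2l.
Qed.

Lemma disjoint_col_bound (X Y : normedModType K) (T : {linear X -> Y}) n N
    (p q r s : \bar R) (q1 : (1 <= q)%E) (qp : (q <= p)%E) (r1 : (1 <= r)%E)
    (rs : (r <= s)%E) (sq' : (s <= hoelder_conjugate q)%E)
    (rps : (r^-1 = p^-1 + s^-1)%E) (W : {linear 'rV[K]_N -> X}) (M : R)
    (sigma : 'I_N -> K) (A : 'M[K]_(n, N)) :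
    (forall a, rnorm (W a) <=
       fin_norm (hoelder_conjugate q) (fun i => rnorm (a ord0 i : K^o))) ->
    fin_norm s (fun i => rnorm (sigma i : K^o)) <= 1 ->
    (forall y : 'I_n -> X, (weak_norm q y <= 1)%E ->
       fin_norm p (fun j => rnorm (T (y j))) <= M) ->
    col_le1 A -> (forall i, disjoint_col A i) ->
  fin_norm r (fun j => rnorm (T (W (\row_i (sigma i * A j i))))) <= M.
Proof.
move=> W1 sigma1 TM A1 Ad.
set q' := hoelder_conjugate q in sq' W1.
have p1 := le_trans q1 qp; have s1 := le_trans r1 rs; have q'1 := le_trans s1 sq'.
pose w j i := rnorm (sigma i * A j i : K^o).
pose beta j := fin_norm s (w j).
have w0 j i : 0 <= w j i by exact: rnorm_ge0.
have beta0 j : 0 <= beta j by exact: fin_norm_ge0.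
(* Exchanging the norms leaves $|\sigma_i|$ times the $\ell_s$ norm of column [i], which is at most
   its $\ell_1$ norm, hence at most 1. *)
have beta1 : fin_norm s beta <= 1.
  apply: le_trans (fin_norm_exchange s1 w0) _.
  apply: le_trans sigma1; apply: ler_fin_norm => // i; rewrite fin_norm_ge0/=.
  have -> : (fun j => w j i) = (fun j => rnorm (sigma i : K^o) * rnorm (A j i : K^o)).
    by apply/funext => j; rewrite /w rnormM.
  rewrite fin_normZ ?rnorm_ge0// => [|j]; last exact: rnorm_ge0.
  rewrite ler_piMr ?rnorm_ge0//.
  apply: le_trans (fin_norm_exponent (lexx 1%E) s1 _) _; first by move=> j; exact: rnorm_ge0.
  by rewrite fin_norm1 => [|j]; [exact: A1|exact: rnorm_ge0].
pose row_ j : 'rV[K]_N := \row_i (sigma i * A j i).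
(* If [beta j] is 0, its inverse is 0 and so is [y j]; this is harmless because [row_ j] then
   vanishes. *)
pose y j := W (scalar_of_real k (beta j)^-1 *: row_ j).
have xE j : W (row_ j) = scalar_of_real k (beta j) *: y j.
  rewrite /y linearZ/= scalerA -scalar_ofM.
  have [b0|b0] := eqVneq (beta j) 0; last by rewrite divff// scalar_of1 scale1r.
  rewrite b0 mul0r scalar_of0 scale0r (_ : row_ j = 0) ?linear0//.
  apply/rowP => i; rewrite !mxE; apply: (@rnorm0_eq0 R k K^o).
  apply/le_anti; rewrite rnorm_ge0 andbT -b0.
  by apply: (fin_norm_ge (f := w j)).
(* By duality it suffices to bound $\sum_j d_j y_j$ for $|d_j| \le c_j$, with [c] in the unit ball
   of $\ell_{q'}^n$. Disjointness leaves at most one nonzero summand per coordinate, so the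
   $\ell_{q'}$ norm can be computed row by row; each normalized row has norm at most 1 because $s\le
   q'$. *)
have yq : (weak_norm q y <= 1)%E.
  apply/weak_norm_le1 => f f1.
  have [c [c0 c1] cf] := hoelder_fin_norm_attained (lexx 1%E) q1 q'1
    (inv_hoelder_conjugate q1) (fun j => rnorm_ge0 (f (y j))).
  apply: le_trans cf _; rewrite fin_norm1 => [|j]; last by rewrite mulr_ge0// rnorm_ge0.
  have [d dc] := sum_rnorm_functional y c0 f1; move/le_trans; apply.
  pose e j := d j * scalar_of_real k (beta j)^-1.
  have -> : \sum_(j < n) d j *: y j = W (\sum_(j < n) e j *: row_ j).
    by rewrite linear_sum/=; apply: eq_bigr => j _; rewrite /y !linearZ/= scalerA mulrC.
  apply: le_trans (W1 _) _.
  pose u i j := rnorm (e j * (sigma i * A j i) : K^o).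
  apply: (@le_trans _ _ (fin_norm q' (fun i => fin_norm q' (u i)))).
    apply: ler_fin_norm => // i; rewrite rnorm_ge0/= summxE.
    apply: le_trans (rnorm_sum_disjoint q'1 _) _ => [j l jl|].
      rewrite !mxE.
      by case: (Ad i j l jl) => ->; [left|right]; rewrite !mulr0.
    apply: ler_fin_norm => // j; rewrite rnorm_ge0/= !mxE; exact: lexx.
  apply: le_trans (fin_norm_exchange q'1 _) _ => [i j|]; first exact: rnorm_ge0.
  apply: le_trans c1; apply: ler_fin_norm => // j; rewrite fin_norm_ge0/=.
  have -> : (fun i => u i j) = (fun i => rnorm (e j : K^o) * w j i).
    by apply/funext => i; rewrite /u rnormM.
  rewrite fin_normZ ?rnorm_ge0//.
  apply: (@le_trans _ _ (rnorm (e j : K^o) * beta j)).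
    by rewrite ler_wpM2l ?rnorm_ge0// fin_norm_exponent.
  apply: le_trans (dc j).
  rewrite /e rnormM rnorm_scalar_of_real ger0_norm ?invr_ge0// -mulrA.
  rewrite ler_piMr ?rnorm_ge0//.
  have [->|b0] := eqVneq (beta j) 0; first by rewrite mulr0.
  by rewrite mulVf.
have -> : (fun j => rnorm (T (W (row_ j)))) =
    (fun j => rnorm (T (y j)) * beta j).
  apply/funext => j; rewrite xE linearZ/= rnormZ rnorm_scalar_of_real.
  by rewrite ger0_norm// mulrC.
apply: le_trans (hoelder_fin_norm r1 p1 s1 rps _ beta0) _.
  by move=> j; exact: rnorm_ge0.
apply: le_trans (TM _ yq); rewrite ler_piMr// fin_norm_ge0//.
Qed.

(** The left side is subadditive and positively homogeneous in [A], so [disjoint_col_ind] extends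
    the bound from matrices with disjoint rows. *)
Lemma col_le1_bound (X Y : normedModType K) (T : {linear X -> Y}) n N
    (p q r s : \bar R) (q1 : (1 <= q)%E) (qp : (q <= p)%E) (r1 : (1 <= r)%E)
    (rs : (r <= s)%E) (sq' : (s <= hoelder_conjugate q)%E)
    (rps : (r^-1 = p^-1 + s^-1)%E) (W : {linear 'rV[K]_N -> X}) (M : R)
    (sigma : 'I_N -> K) (A : 'M[K]_(n, N)) :
    (forall a, rnorm (W a) <=
       fin_norm (hoelder_conjugate q) (fun i => rnorm (a ord0 i : K^o))) ->
    fin_norm s (fun i => rnorm (sigma i : K^o)) <= 1 ->
    (forall y : 'I_n -> X, (weak_norm q y <= 1)%E ->
       fin_norm p (fun j => rnorm (T (y j))) <= M) ->
    col_le1 A ->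
  fin_norm r (fun j => rnorm (T (W (\row_i (sigma i * A j i))))) <= M.
Proof.
move=> W1 sigma1 TM; pose Phi (B : 'M[K]_(n, N)) :=
  fin_norm r (fun j => rnorm (T (W (\row_i (sigma i * B j i))))).
apply: (@disjoint_col_ind _ _ Phi).
- move=> B C; apply: le_trans (ler_fin_normD r1 _ _) => [|j|j]; try exact: rnorm_ge0.
  apply: ler_fin_norm => // j; rewrite rnorm_ge0/=.
  have -> : \row_i (sigma i * (B + C) j i) =
      \row_i (sigma i * B j i) + \row_i (sigma i * C j i).
    by apply/rowP => i; rewrite !mxE mulrDr.
  by rewrite !linearD/= ler_rnormD.
- move=> t B t0; rewrite /Phi -fin_normZ// => [|j]; last exact: rnorm_ge0.
  apply: ler_fin_norm => // j; rewrite rnorm_ge0/=.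
  have -> : \row_i (sigma i * (scalar_of_real k t *: B) j i) =
      scalar_of_real k t *: \row_i (sigma i * B j i).
    by apply/rowP => i; rewrite !mxE mulrCA.
  by rewrite !linearZ/= rnormZ rnorm_scalar_of_real ger0_norm.
- by move=> B B1 Bd; exact: (disjoint_col_bound q1 qp r1 rs sq' rps).
Qed.

End DisjointColumns.

(** * The two inequalities *)

Section Directions.
Context {R : realType} {k : scalar_kind}.
Local Notation K := (scalar_field R k).
Local Open Scope ring_scope.

Section EllMaps.
Variables (p : \bar R) (p1 : (1 <= p)%E).

Definition ell_coord (i : nat) (x : ell k p1) : K^o := x i.

Lemma ell_coord_is_linear i : linear (ell_coord i).
Proof. by []. Qed.

HB.instance Definition _ i := GRing.isLinear.Build K (ell k p1) K^o _
  (ell_coord i) (ell_coord_is_linear i).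

Lemma rnorm_ell_coord i (x : ell k p1) : rnorm (ell_coord i x) <= rnorm x.
Proof.
rewrite -lee_fin rnorm_ell; apply: le_trans (fin_norm_le_seq_norm i.+1 x p1).
rewrite lee_fin (fin_norm_ge (f := fun j : 'I_i.+1 => rnorm (x j)) ord_max)// => j.
exact: rnorm_ge0.
Qed.

Definition ell_comb (X : normedModType K) n (x : 'I_n -> X) (a : ell k p1) : X :=
  \sum_(i < n) a i *: x i.

Lemma ell_comb_is_linear (X : normedModType K) n (x : 'I_n -> X) :
  linear (ell_comb x).
Proof.
move=> c a b; rewrite /ell_comb scaler_sumr -big_split; apply: eq_bigr => i _ /=.
by rewrite scalerA -scalerDl.
Qed.

HB.instance Definition _ (X : normedModType K) n (x : 'I_n -> X) :=
  GRing.isLinear.Build K (ell k p1) X _ (ell_comb x) (ell_comb_is_linear x).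

End EllMaps.

(** A functional norming $\sum_i a_i x_i$ reduces the claim to Hölder's inequality for $q$ and
    $q'$. *)
Lemma rnorm_ell_comb (q : \bar R) (q1 : (1 <= q)%E) (X : normedModType K) n
    (x : 'I_n -> X) (a : ell k (hoelder_conj_ge1 q1)) :
  (weak_norm q x <= 1)%E -> rnorm (ell_comb x a) <= rnorm a.
Proof.
move=> /weak_norm_le1 x1; have [f [f1 <-]] := norming_functional (ell_comb x a).
rewrite /ell_comb linear_sum/=.
apply: le_trans (ler_rnorm_sum _) _.
under eq_bigr do rewrite linearZ/= rnormM mulrC.
rewrite -fin_norm1 => [|i]; last by rewrite mulr_ge0 ?rnorm_ge0.
apply: le_trans (hoelder_fin_norm (lexx 1%E) q1 (hoelder_conj_ge1 q1)
  (inv_hoelder_conjugate q1) _ _) _ => [i|i|]; try exact: rnorm_ge0.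
apply: le_trans (ler_piMl (fin_norm_ge0 _ _) (x1 f f1)) _.
by rewrite -lee_fin rnorm_ell; exact: fin_norm_le_seq_norm (hoelder_conj_ge1 q1).
Qed.

(** For a contractive [f], $\sum_j |f(e_j)|$ is at most the sup norm of some $\sum_j d_j e_j$ with
    $|d_j|\le 1$. *)
Lemma weak_norm_fin_seq_delta n :
  (weak_norm 1 (fun j : 'I_n => fin_seq (leey 1) (delta_mx ord0 j : 'rV[K]_n)) <= 1)%E.
Proof.
apply/weak_norm_le1 => f f1; rewrite fin_norm1 => [|j]; last exact: rnorm_ge0.
pose e (j : 'I_n) := fin_seq (leey 1) (delta_mx ord0 j : 'rV[K]_n).
have [d d1] := sum_rnorm_functional e (fun=> ler01) f1.
under eq_bigr do rewrite mul1r; move=> /le_trans; apply.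
have -> : \sum_(j < n) d j *: e j = fin_seq (leey 1) (\row_j d j).
  rewrite [\row_j d j]row_sum_delta linear_sum/=; apply: eq_bigr => j _.
  by rewrite mxE linearZ.
apply: le_trans (rnorm_fin_seq _ _) _.
by apply: fin_normyP => // j; rewrite mxE d1.
Qed.

(** Serves the case $s=\infty$, where $q'=\infty$. The exponent stays a variable with an equation
    because the type of [sigma] depends on it. *)
Lemma diag_op_contraction (p : \bar R) (p1 : (1 <= p)%E) (sigma : ell k p1)
    (tau : ell k (leey (1 : \bar R))) :
  p = +oo%E -> (seq_norm +oo sigma <= 1)%E ->
  rnorm (diag_op sigma tau) <= rnorm tau.
Proof.
move=> poo sigma1; rewrite -lee_fin !rnorm_ell/=.
have -> : (fun i => sigma i * tau i : K^o) = (fun i => tau i * sigma i).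
  by apply/funext => i; rewrite mulrC.
apply: (le_trans (seq_normM_le _ p1 _)); last by rewrite poo.
by move=> i; rewrite -lee_fin (le_trans (rnorm_le_seq_normy _ _)).
Qed.

Lemma summing_norm_factor_le (X Y : normedModType K) (T : {linear X -> Y})
    (p q r s : \bar R) (q1 : (1 <= q)%E) (qp : (q <= p)%E) (r1 : (1 <= r)%E)
    (rs : (r <= s)%E) (sq' : (s <= hoelder_conjugate q)%E)
    (rps : (r^-1 = p^-1 + s^-1)%E) n (M : R)
    (V : {linear ell k (hoelder_conj_ge1 q1) -> X})
    (sigma : ell k (hoelder_conj_ge1 q1))
    (tau : 'I_n -> ell k (leey (1 : \bar R))) :
    bounded_op T ->
    (forall y : 'I_n -> X, (weak_norm q y <= 1)%E ->
       fin_norm p (fun j => rnorm (T (y j))) <= M) ->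
    (forall a, rnorm (V a) <= rnorm a) -> (seq_norm s sigma <= 1)%E ->
    (weak_norm 1 tau <= 1)%E ->
  fin_norm r (fun j => rnorm (T (V (diag_op sigma (tau j))))) <= M.
Proof.
move=> bT TM V1 sigma1 tau1.
pose q'1 := hoelder_conj_ge1 q1; have s1 := le_trans r1 rs.
case: s s1 rs sq' rps sigma1 => [s| |] // s1 rs sq' rps sigma1; last first.
  (* Here $s=\infty$ forces $q'=\infty$, hence $q=1$ and $r=p$, and the vectors $V D_\sigma\tau_j$
     can be used directly. *)
  have q'oo : hoelder_conjugate q = +oo%E by apply/eqP; rewrite -leye_eq.
  have qE := hoelder_conjugate_eqy q'oo.
  have -> : r = p by apply: (can_inj (@inveK R)); rewrite rps invey adde0.
  apply: TM; apply/weak_norm_le1 => f f1.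
  have -> : @fin_norm R q n = @fin_norm R 1 n by rewrite qE.
  move/weak_norm_le1 : tau1 => /(_ (f \o V \o diag_op sigma)); apply=> t /=.
  by apply: le_trans (f1 _) _; apply: le_trans (V1 _) _; exact: diag_op_contraction.
(* Testing the weak norm on the [i]-th coordinate functional places each column in the unit ball of
   $\ell_1^n$. *)
have tauA i : \sum_(j < n) rnorm (tau j i : K^o) <= 1.
  rewrite -fin_norm1 => [|j]; last exact: rnorm_ge0.
  by move/weak_norm_le1 : tau1 => /(_ (ell_coord i)); apply; exact: rnorm_ell_coord.
have tau_le1 j i : rnorm (tau j i : K^o) <= 1.
  apply: le_trans (tauA i); rewrite (bigD1 j)//= lerDl sumr_ge0// => l _.
  exact: rnorm_ge0.
have /bounded_opP[C TC] := bT.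
(* Truncation errors of size at most $\delta$ in all [n] vectors contribute at most $D\delta$ after
   applying [T]; dividing by [D + 1] below avoids a zero denominator. *)
pose D := `|C| * fin_norm r (fun _ : 'I_n => 1).
have D0 : 0 <= D by rewrite mulr_ge0// fin_norm_ge0.
apply/ler_addgt0Pr => e e0.
have eD0 : 0 < e / (D + 1) by rewrite divr_gt0// ltr_wpDl.
have [N tailN] : exists N, (seq_norm s%:E (tail_seq N sigma) <= (e / (D + 1))%:E)%E.
  apply: tail_seq_norm_small => //; exact: le_lt_trans sigma1 (ltry _).
pose W : {linear 'rV[K]_N -> X} := V \o @fin_seq R k _ q'1 N.
pose A : 'M[K]_(n, N) := \matrix_(j, i) tau j i.
pose row_ j : 'rV[K]_N := \row_i (sigma i * A j i).
have main : fin_norm r (fun j => rnorm (T (W (row_ j)))) <= M.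
  apply: (col_le1_bound q1 qp r1 rs sq' rps) => //.
  - by move=> a; apply: le_trans (V1 _) _; exact: rnorm_fin_seq.
  - by rewrite -lee_fin (le_trans _ sigma1)// fin_norm_le_seq_norm.
  - by move=> i; under eq_bigr do rewrite mxE.
(* The difference is the tail of [sigma] times [tau j], whose entries are at most 1 in absolute
   value; its $\ell_{q'}$ norm is at most the $\ell_s$ norm of the tail. *)
have err j : rnorm (diag_op sigma (tau j) - fin_seq q'1 (row_ j)) <= e / (D + 1).
  rewrite -lee_fin rnorm_ell; apply: le_trans tailN.
  apply: le_trans (seq_norm_exponent _ s1 sq').
  apply: le_trans (seq_normM_le _ q'1 (tau_le1 j)).
  rewrite le_eqVlt; apply/orP; left; apply/eqP; congr seq_norm.
  apply/funext => i.
  change (sigma i * tau j i - fin_seq_fun (row_ j) i = tail_seq N sigma i * tau j i).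
  rewrite /tail_seq; case: ltnP => iN; last by rewrite fin_seq_fun_out// subr0.
  by rewrite (fin_seq_funE (row_ j) (Ordinal iN)) !mxE/= subrr mul0r.
apply: (@le_trans _ _ (fin_norm r (fun j => rnorm (T (W (row_ j))) +
    (`|C| * (e / (D + 1))) * 1))).
  apply: ler_fin_norm => // j; rewrite rnorm_ge0/= mulr1.
  have -> : T (V (diag_op sigma (tau j))) =
      T (V (fin_seq q'1 (row_ j))) + T (V (diag_op sigma (tau j) - fin_seq q'1 (row_ j))).
    by rewrite -linearD -linearD [in RHS]addrC subrK.
  apply: le_trans (ler_rnormD _ _) _; apply: lerD; first exact: lexx.
  apply: le_trans (TC _) _; apply: le_trans (ler_wpM2r (rnorm_ge0 _) (ler_norm C)) _.
  by rewrite ler_wpM2l//; apply: le_trans (V1 _) _.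
have Ce0 : 0 <= `|C| * (e / (D + 1)) by rewrite mulr_ge0// ltW.
apply: le_trans (ler_fin_normD r1 _ _) _ => [j|j|]; first exact: rnorm_ge0.
  by rewrite mulr1.
rewrite lerD// fin_normZ// mulrAC -/D mulrCA ler_piMr ?(ltW e0)//.
by rewrite ler_pdivrMr ?mul1r ?lerDl// ltr_wpDl.
Qed.

(** The multiplier is finitely supported, so it lies in $\ell_{q'}$ as its type requires, while its
    norm is controlled in $\ell_s$. *)
Lemma fin_norm_factor (X Y : normedModType K) (T : {linear X -> Y})
    (p q r s : \bar R) (q1 : (1 <= q)%E) (qp : (q <= p)%E) (r1 : (1 <= r)%E)
    (rs : (r <= s)%E) (rps : (r^-1 = p^-1 + s^-1)%E) n (x : 'I_n -> X) :
    (weak_norm q x <= 1)%E ->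
  exists sigma : ell k (hoelder_conj_ge1 q1), (seq_norm s sigma <= 1)%E /\
    ((fin_norm p (fun i => rnorm (T (x i))))%:E <=
     summing_norm r 1 n (T \o ell_comb x \o diag_op sigma))%E.
Proof.
move=> x1; have p1 := le_trans q1 qp; have s1 := le_trans r1 rs.
pose q'1 := hoelder_conj_ge1 q1.
have [mu [mu0 mu1] Tmu] := hoelder_fin_norm_attained r1 p1 s1 rps
  (fun i => rnorm_ge0 (T (x i))).
pose m : 'rV[K]_n := \row_i scalar_of_real k (mu i).
have mE i : rnorm (m ord0 i : K^o) = mu i.
  by rewrite mxE rnorm_scalar_of_real ger0_norm.
exists (fin_seq q'1 m); split.
  apply: le_trans (seq_norm_fin_seq m s1) _.
  by rewrite lee_fin; have -> : (fun i => rnorm (m ord0 i : K^o)) = mu by exact/funext.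
apply: (@le_trans _ _ (fin_norm r (fun i => mu i * rnorm (T (x i))))%:E).
  by rewrite lee_fin.
apply: ereal_sup_ubound.
exists (fun j : 'I_n => fin_seq (leey 1) (delta_mx ord0 j : 'rV[K]_n)).
  exact: weak_norm_fin_seq_delta.
congr (fin_norm _ _)%:E; apply/funext => j /=.
suff -> : ell_comb x (diag_op (fin_seq q'1 m)
    (fin_seq (leey 1) (delta_mx ord0 j : 'rV[K]_n))) = m ord0 j *: x j.
  by rewrite linearZ/= rnormZ mE.
rewrite /ell_comb (bigD1 j)//= big1 ?addr0 => [|i ij].
  by rewrite !fin_seq_funE [delta_mx _ _ _ _]mxE !eqxx mulr1.
by rewrite !fin_seq_funE [delta_mx _ _ _ _]mxE (negbTE ij) andbF mulr0 scale0r.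
Qed.

End Directions.

Theorem theorem2 (R : realType) (k : scalar_kind) (p q r s : \bar R)
    (q1 : 1 <= q) (qp : q <= p) (r1 : 1 <= r) (rs : r <= s)
    (sq' : s <= hoelder_conjugate q) (rps : r^-1 = p^-1 + s^-1)
    (X Y : completeNormedModType (scalar_field R k)) (T : {linear X -> Y})
    (bT : bounded_op T) (n : nat) :
  summing_norm p q n T =
  ereal_sup
    [set summing_norm r 1 n (T \o V \o diag_op sigma)
    | V in [set V : {linear ell k (hoelder_conj_ge1 q1) -> X}
           | bounded_op V /\ op_norm V <= 1]
    & sigma in [set sigma : ell k (hoelder_conj_ge1 q1)
               | seq_norm s sigma <= 1]].
Proof.
apply/le_anti/andP; split.
  apply: ge_ereal_sup => _ [x /= x1 <-].
  have [sigma [sigma1 Tx]] := fin_norm_factor T q1 qp r1 rs rps x1.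
  apply: le_trans Tx _; apply: ereal_sup_ubound.
  exists (ell_comb x); last by exists sigma.
  by apply/contractionP => a; exact: rnorm_ell_comb.
apply: ge_ereal_sup => _ [V /contractionP V1] [sigma sigma1 <-].
apply: ge_ereal_sup => _ [tau /= tau1 <-].
have TM (y : 'I_n -> X) : weak_norm q y <= 1 ->
    (fin_norm p (fun j => rnorm (T (y j))))%:E <= summing_norm p q n T.
  by move=> y1; apply: ereal_sup_ubound; exists y.
(* The zero family excludes the value $-\infty$ for the summing norm; for $+\infty$ there is nothing
   to prove, so a real bound [M] remains. *)
have w0 : weak_norm q (fun _ : 'I_n => (0 : X)%R) <= 1.
  apply/weak_norm_le1 => f _; under eq_fun do rewrite linear0 rnorm0.
  by rewrite fin_norm0.
have := TM _ w0; move: TM; case: (summing_norm p q n T) => [M| |] TM M0 //; last by rewrite leey.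
rewrite lee_fin.
by apply: (summing_norm_factor_le qp r1 rs sq' rps bT).
Qed.
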